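(* Let $r_1,r_2\ge 0$ and let $X=S^1_{r_1}\vee S^1_{r_2}$ be the wedge sum of two circles, where each $S^1_{r_i}$ is a copy of $[0,1]/(0\sim1)$ endowed with the Čech closure operator $c_{r_i}$, $i\in\{1,2\}$. For $U\subset X$ define the Čech closure operator $c_X(U)=c_{r_1}(U\cap S^1_{r_1})\cup c_{r_2}(U\cap S^1_{r_2})$. Then $$\pi_1(X)\cong\begin{cases}F_{a,b}&\text{if } r_1,r_2<\frac13,\\ \mathbb{Z}&\text{if } r_i<\frac13,\ r_j\ge\frac12,\ i\ne j,\\ 1&\text{if } r_1,r_2\ge\frac12,\end{cases}$$ where $F_{a,b}$ denotes the free group on two generators.
   Context: A Čech closure space $(X,c)$ is a set $X$ with a map $c:\mathcal{P}(X)\to\mathcal{P}(X)$ such that $c(\emptyset)=\emptyset$, $A\subseteq c(A)$, and $c(A\cup B)=c(A)\cup c(B)$ (not assumed $c^2=c$). A topological space is a closure space via its topological closure. A map $f:(X,c_X)\to(Y,c_Y)$ is continuous iff $f(c_X(A))\subseteq c_Y(f(A))$ for all $A\subseteq X$. $U$ is a neighborhood of $x$ if $x\in X\setminus c(X\setminus U)$. The product closure structure on $X\times Y$ is the one in which, at each point $(x,y)$, the sets $V\times W$ ($V$ a neighborhood of $x$, $W$ a neighborhood of $y$) form a local base of neighborhoods. For a metric space $(X,d)$ and $r\ge 0$, $c_r(A)=\{x\in X\mid d(x,A)\le r\}$, where $d(x,A)=\inf_{y\in A}d(x,y)$ (and $c_r(\emptyset)=\emptyset$). The circle $S^1=[0,1]/(0\sim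 1)=\mathbb{R}/\mathbb{Z}$ has the quotient metric $d([x],[y])=\min_{k\in\mathbb{Z}}|x-y+k|$. As a set, the wedge sum is the disjoint union of the two circles with the points $0$ of the two circles identified; each circle is regarded as a subset of $X$. $I=[0,1]$ has its usual topology. $\pi_1(X,* )$ is the group of homotopy classes rel $\partial I$ of continuous loops $v:I\to(X,c)$ based at $*$ (homotopies are continuous maps $I\times I\to (X,c)$ fixed on $\partial I$), with product given by concatenation; the basepoint is the wedge point and is suppressed from the notation. *)

(* Defs.v *)
From HB Require Import structures.
From mathcomp Require Import all_boot all_order all_algebra.
From mathcomp Require Import all_classical all_reals all_analysis wedge_sigT.
From mathcomp Require Import ring lra.

Set Implicit Arguments.
Unset Strict Implicit.
Unset Printing Implicit Defensive.

Import Order.TTheory GRing.Theory Num.Theory.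
Import numFieldNormedType.Exports.

Local Open Scope classical_set_scope.
Local Open Scope ring_scope.
Local Open Scope quotient_scope.

(* Not assumed idempotent, hence weaker than a topological closure. *)
Record cech (T : Type) := Cech {
  cech_cl :> set T -> set T;
  cech_cl0 : cech_cl set0 = set0;
  cech_sub : forall A, A `<=` cech_cl A;
  cech_clU : forall A B, cech_cl (A `|` B) = cech_cl A `|` cech_cl B }.

Definition cech_nbhs T (c : cech T) (x : T) (U : set T) : Prop :=
  (~` c (~` U)) x.

Definition cech_continuous T U (c : cech T) (d : cech U) (f : T -> U) : Prop :=
  forall A, f @` (c A) `<=` d (f @` A).

Section cech_theory.
Variables (T U V : Type) (c : cech T) (d : cech U) (e : cech V).

Lemma cech_mono (A B : set T) : A `<=` B -> c A `<=` c B.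
Proof. by move=> /setUidPr <-; rewrite cech_clU; exact: subsetUl. Qed.

Lemma cech_nbhsI x (A B : set T) :
  cech_nbhs c x A -> cech_nbhs c x B -> cech_nbhs c x (A `&` B).
Proof. by rewrite /cech_nbhs setCI cech_clU setCU => Ax Bx; split. Qed.

Lemma cech_continuous_comp (f : T -> U) (g : U -> V) :
  cech_continuous c d f -> cech_continuous d e g ->
  cech_continuous c e (g \o f).
Proof.
move=> cf cg A _ [x cAx <-]; rewrite -image_comp; apply: cg.
by exists (f x) => //; apply: cf; exists x.
Qed.

Lemma cech_continuous_cst (y : U) : cech_continuous c d (fun=> y).
Proof.
move=> A _ [x cAx <-]; apply: cech_sub.
have [A0|/set0P[a Aa]] := eqVneq A set0; last by exists a.
by move: cAx; rewrite A0 cech_cl0.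
Qed.

End cech_theory.

Section cech_topology.
Variable T : topologicalType.

Definition cech_top : cech T :=
  Cech (@closure0 T) (@subset_closure T) (@closureU T).

End cech_topology.

Section cech_product.
Variables (T U : Type) (c : cech T) (d : cech U).

(* The sets V `*` W form a base of neighborhoods at each point, so a point is
   in the closure of S iff all of them meet S. *)
Definition cech_prod_cl (S : set (T * U)) : set (T * U) :=
  [set p | forall V W, cech_nbhs c p.1 V -> cech_nbhs d p.2 W ->
    (V `*` W) `&` S !=set0].

Lemma cech_prod_cl0 : cech_prod_cl set0 = set0.
Proof.
rewrite -subset0 => p /(_ setT setT).
rewrite /cech_nbhs !setCT !cech_cl0 !setC0 => /(_ I I).
by rewrite setI0 => -[].
Qed.

Lemma cech_prod_sub S : S `<=` cech_prod_cl S.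
Proof.
move=> p Sp V W Vp Wp; exists p; split => //; split; apply: contrapT => nVW.
- by apply: Vp; exact: cech_sub.
- by apply: Wp; exact: cech_sub.
Qed.

Lemma cech_prod_clU A B :
  cech_prod_cl (A `|` B) = cech_prod_cl A `|` cech_prod_cl B.
Proof.
apply/seteqP; split=> p.
- move=> clp; apply: contrapT => /not_orP[].
  move=> /existsNP[V /existsNP[W /not_implyP[Vp /not_implyP[Wp nA]]]].
  move=> /existsNP[V' /existsNP[W' /not_implyP[Vp' /not_implyP[Wp' nB]]]].
  have [q [[[q1 q1'] [q2 q2']] [Aq|Bq]]] :=
    clp _ _ (cech_nbhsI Vp Vp') (cech_nbhsI Wp Wp').
  + by apply: nA; exists q.
  + by apply: nB; exists q.
- by move=> [] clp V W Vp Wp; have [q [qVW qS]] := clp V W Vp Wp;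
    exists q; split=> //; [left|right].
Qed.

Definition cech_prod : cech (T * U) :=
  Cech cech_prod_cl0 cech_prod_sub cech_prod_clU.

End cech_product.

Section cech_topology_theory.
Variables (T U : topologicalType).

Lemma cech_nbhs_top (S : topologicalType) (x : S) V :
  cech_nbhs (cech_top S) x V = nbhs x V.
Proof. by rewrite /cech_nbhs [cech_cl _ _]closure_setC setCK. Qed.

Lemma cech_prod_top (S : set (T * U)) :
  cech_prod (cech_top T) (cech_top U) S = closure S.
Proof.
apply/seteqP; split=> p clp.
- move=> B [[V W] /= [Vp Wp] VWB].
  have [|| q [qVW qS]] := clp V W; rewrite ?cech_nbhs_top//.
  by exists q; split=> //; exact: VWB.
- move=> V W; rewrite !cech_nbhs_top => Vp Wp.
  have [|q [Sq VWq]] := clp (V `*` W); first by exists (V, W).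
  by exists q.
Qed.

Lemma continuous_cech (f : T -> U) :
  continuous f -> cech_continuous (cech_top T) (cech_top U) f.
Proof.
move=> cf A _ [x clx <-] B /cf /clx[y [Ay By]].
by exists (f y); split=> //; exists y.
Qed.

End cech_topology_theory.

Section cech_metric.
Variables (R : realType) (M : metricType R) (r : R).

(* The nonemptiness is needed since inf set0 = 0. *)
Definition metric_cl (A : set M) : set M :=
  [set x | A !=set0 /\ inf [set mdist x y | y in A] <= r].

Lemma metric_cl0 : metric_cl set0 = set0.
Proof. by rewrite -subset0 => x [[]]. Qed.

Let has_lb (x : M) (A : set M) : has_lbound [set mdist x y | y in A].
Proof. by exists 0 => _ [y _ <-]; exact: mdist_ge0. Qed.

Lemma metric_cl_sub (r_ge0 : 0 <= r) A : A `<=` metric_cl A.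
Proof.
move=> x Ax; split; first by exists x.
apply: le_trans r_ge0; rewrite -[leRHS](mdistxx x).
by apply: ge_inf => //; exists x.
Qed.

Lemma metric_clU A B : metric_cl (A `|` B) = metric_cl A `|` metric_cl B.
Proof.
apply/seteqP; split=> x.
- move=> [[z ABz] ler].
  have [A0|/set0P A0] := eqVneq A set0.
    by right; move: ler ABz; rewrite A0 set0U => ? ?; split=> //; exists z.
  have [B0|/set0P B0] := eqVneq B set0.
    by left; move: ler ABz; rewrite B0 setU0 => ? ?; split=> //; exists z.
  have [lA|gA] := leP (inf [set mdist x y | y in A]) r; first by left.
  right; split=> //; rewrite leNgt; apply/negP => gB.
  move: ler; rewrite leNgt => /negP; apply.
  apply: lt_le_trans (_ : Num.min (inf [set mdist x y | y in A])
      (inf [set mdist x y | y in B]) <= _).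
    by rewrite lt_min gA gB.
  apply: lb_le_inf; first by exists (mdist x z), z.
  move=> _ [y [Ay|By] <-]; rewrite ge_min.
  + by rewrite ge_inf //; exists y.
  + by rewrite (@ge_inf _ [set mdist x y | y in B]) ?orbT//; exists y.
- have le_infU S : S `<=` A `|` B -> metric_cl S x ->
      metric_cl (A `|` B) x.
    move=> SAB [[z Sz] ler]; split; first by exists z; exact: SAB.
    apply: le_trans ler; apply: lb_le_inf; first by exists (mdist x z), z.
    by move=> _ [y Sy <-]; apply: ge_inf => //; exists y => //; exact: SAB.
  by move=> [|]; apply: le_infU; [exact: subsetUl|exact: subsetUr].
Qed.

Definition cech_metric (r_ge0 : 0 <= r) : cech M :=
  Cech metric_cl0 (metric_cl_sub r_ge0) metric_clU.

End cech_metric.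
Arguments cech_metric {R} M {r} r_ge0.

Section circle.
Variable R : realType.

Definition circle_eq (x y : R) : bool := x - y \is a Num.int.

Lemma circle_eq_refl : reflexive circle_eq.
Proof. by move=> x; rewrite /circle_eq subrr rpred0. Qed.

Lemma circle_eq_sym : symmetric circle_eq.
Proof. by move=> x y; rewrite /circle_eq -opprB rpredN. Qed.

Lemma circle_eq_trans : transitive circle_eq.
Proof.
move=> y x z; rewrite /circle_eq => xy yz.
by rewrite -(subrKA y) rpredD.
Qed.

Canonical circle_equiv :=
  EquivRel circle_eq circle_eq_refl circle_eq_sym circle_eq_trans.

Definition circle : Type := {eq_quot circle_eq}.
HB.instance Definition _ := Choice.on circle.
HB.instance Definition _ := EqQuotient.on circle.

Lemma circleP (x y : R) :
  reflect (exists k : int, y = x + k%:~R) (\pi_circle x == \pi_circle y).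
Proof.
rewrite eq_sym eqmodE /= /circle_eq; apply: (iffP intrP) => -[k].
- by move=> yx; exists k; rewrite -yx addrC subrK.
- by move=> ->; exists k; rewrite addrC addKr.
Qed.

(* The infimum is a minimum and does not depend on the representatives, see
   circle_dist_min. *)
Definition circle_dist (p q : circle) : R :=
  inf [set `|repr p - repr q + k%:~R| | k in [set: int]].

Lemma circle_dist_min (x y : R) : exists2 k : int,
  circle_dist (\pi_circle x) (\pi_circle y) = `|x - y + k%:~R| &
  forall m : int, `|x - y + k%:~R| <= `|x - y + m%:~R|.
Proof.
set x' := repr (\pi_circle x); set y' := repr (\pi_circle y).
have /circleP[a x'E] : \pi_circle x == \pi_circle x' by rewrite reprK.
have /circleP[b y'E] : \pi_circle y == \pi_circle y' by rewrite reprK.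
have kminP (z : R) : exists k : int, forall m : int,
    `|z + k%:~R| <= `|z + m%:~R|.
  have /andP[] := floor_itv z; move: (Num.floor z) => f fz.
  rewrite intrD => zf.
  have key (m : int) : `|z + m%:~R| >= Num.min (z - f%:~R) (f%:~R + 1 - z).
    have [mf|mf] := lerP (- f) m.
      have : (- f)%:~R <= m%:~R :> R by rewrite ler_int.
      rewrite intrN => ?; rewrite ge_min ger0_norm; last lra.
      by apply/orP; left; lra.
    have : (m + 1)%:~R <= (- f)%:~R :> R by rewrite ler_int lezD1.
    rewrite intrD intrN => ?; rewrite ge_min ler0_norm; last lra.
    by apply/orP; right; lra.
  have [c|c] := leP (z - f%:~R) (f%:~R + 1 - z).
  - exists (- f) => m; apply: le_trans (key m).
    rewrite intrN ger0_norm; last lra.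
    by rewrite le_min; apply/andP; split; lra.
  - exists (- f - 1) => m; apply: le_trans (key m).
    rewrite intrB intrN ler0_norm; last lra.
    by rewrite le_min; apply/andP; split; lra.
have [k kmin] := kminP (x - y).
exists k => //; rewrite /circle_dist -/x' -/y'.
have sh (m : int) : `|x' - y' + m%:~R| = `|x - y + (a - b + m)%:~R|.
  by rewrite x'E y'E intrD intrB; congr `|_|; ring.
apply/eqP; rewrite eq_le; apply/andP; split.
- apply: ge_inf; first by exists 0 => _ [m _ <-].
  by exists (k - (a - b)) => //; rewrite sh; congr (`|_ + _%:~R|); ring.
- apply: lb_le_inf; first by exists `|x' - y' + 0%:~R|, 0.
  by move=> _ [m _ <-]; rewrite sh.
Qed.

Lemma circle_distxx p : circle_dist p p = 0.
Proof.
have [k + kmin] := circle_dist_min (repr p) (repr p); rewrite !reprK => ->.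
apply/eqP; rewrite eq_le normr_ge0 andbT.
by apply: le_trans (kmin 0) _; rewrite subrr addr0 normr0.
Qed.

Lemma circle_dist_positivity p q : circle_dist p q = 0 -> p = q.
Proof.
have [k + _] := circle_dist_min (repr p) (repr q); rewrite !reprK => -> /eqP.
rewrite normr_eq0 => /eqP pqk; rewrite -[p]reprK -[q]reprK.
apply/eqP/circleP; exists k; move: pqk.
by move: (repr p) (repr q) => x y /= pqk; lra.
Qed.

Lemma circle_dist_le p q (x y : R) (k : int) :
  p = \pi_circle x -> q = \pi_circle y -> circle_dist p q <= `|x - y + k%:~R|.
Proof.
by move=> -> ->; have [m -> mmin] := circle_dist_min x y; exact: mmin.
Qed.

Lemma circle_dist_sym p q : circle_dist p q = circle_dist q p.
Proof.
suff le p' q' : circle_dist p' q' <= circle_dist q' p'.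
  by apply/eqP; rewrite eq_le !le.
have [k + _] := circle_dist_min (repr q') (repr p'); rewrite !reprK => ->.
rewrite -normrN (_ : - (_ - _ + _) = repr p' - repr q' + (- k)%:~R); last first.
  by rewrite intrN; ring.
by apply: circle_dist_le; rewrite reprK.
Qed.

Lemma circle_dist_triangle q p s :
  circle_dist p s <= circle_dist p q + circle_dist q s.
Proof.
have [k + _] := circle_dist_min (repr p) (repr q); rewrite !reprK => ->.
have [m + _] := circle_dist_min (repr q) (repr s); rewrite !reprK => ->.
apply: le_trans (ler_normD _ _).
rewrite (_ : _ + (_ - _ + m%:~R) = repr p - repr s + (k + m)%:~R); last first.
  by rewrite intrD; ring.
by apply: circle_dist_le; rewrite reprK.
Qed.

HB.instance Definition _ := isMetric.Build R circle
  circle_distxx circle_dist_positivity circle_dist_sym circle_dist_triangle.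

Lemma circle_mdistE (p q : circle) : mdist p q = circle_dist p q.
Proof. by []. Qed.

End circle.

(* Only the underlying set of the library's wedge matters here: its quotient
   topology plays no role, the closure being given by wedge_circles_cl. *)
Section wedge_of_circles.
Variable R : realType.

Definition circle0 : circle R := \pi_(circle R) 0.

Definition wedge_circles : Type :=
  @wedge bool (fun=> circle R) (fun=> circle0).

Definition incl1 (p : circle R) : wedge_circles :=
  @wedge_lift bool (fun=> circle R) (fun=> circle0) false p.

Definition incl2 (p : circle R) : wedge_circles :=
  @wedge_lift bool (fun=> circle R) (fun=> circle0) true p.

Definition wedge_pt : wedge_circles := incl1 circle0.

Lemma wedge_pt2 : wedge_pt = incl2 circle0.
Proof.
exact: (@wedge_liftE bool (fun=> circle R) (fun=> circle0)
          true circle0 false circle0).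
Qed.

Lemma wedge_circlesP (x : wedge_circles) :
  (exists p, x = incl1 p) \/ (exists p, x = incl2 p).
Proof.
rewrite -[x](@reprK _ (@wedge bool (fun=> circle R) (fun=> circle0))).
by case: (repr _) => -[] p; [right|left]; exists p.
Qed.

Lemma incl1_inj : injective incl1.
Proof.
move=> p q /eqmodP/predU1P[|/andP[/eqP/= -> /eqP/= ->]//].
exact: existT_inj2.
Qed.

Lemma incl2_inj : injective incl2.
Proof.
move=> p q /eqmodP/predU1P[|/andP[/eqP/= -> /eqP/= ->]//].
exact: existT_inj2.
Qed.

Lemma incl12 p q : incl1 p = incl2 q -> p = circle0 /\ q = circle0.
Proof. by move=> /eqmodP/predU1P[//|/andP[/eqP/= -> /eqP/= ->]]. Qed.

Variables (r1 r2 : R) (r1_ge0 : 0 <= r1) (r2_ge0 : 0 <= r2).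

Let c1 := cech_metric (circle R) r1_ge0.
Let c2 := cech_metric (circle R) r2_ge0.

Definition wedge_circles_cl (S : set wedge_circles) : set wedge_circles :=
  incl1 @` c1 (incl1 @^-1` S) `|` incl2 @` c2 (incl2 @^-1` S).

Lemma wedge_circles_cl0 : wedge_circles_cl set0 = set0.
Proof.
by rewrite /wedge_circles_cl !preimage_set0 !cech_cl0 !image_set0 setU0.
Qed.

Lemma wedge_circles_sub S : S `<=` wedge_circles_cl S.
Proof.
move=> x Sx; have [[p xE]|[p xE]] := wedge_circlesP x; [left|right].
- by exists p => //; apply: cech_sub; rewrite /preimage /= -xE.
- by exists p => //; apply: cech_sub; rewrite /preimage /= -xE.
Qed.

Lemma wedge_circles_clU S T :
  wedge_circles_cl (S `|` T) = wedge_circles_cl S `|` wedge_circles_cl T.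
Proof.
by rewrite /wedge_circles_cl !preimage_setU !cech_clU !image_setU setUACA.
Qed.

Definition cech_wedge_circles : cech wedge_circles :=
  Cech wedge_circles_cl0 wedge_circles_sub wedge_circles_clU.

End wedge_of_circles.

Section unit_interval.
Variable R : realType.

Definition unitI : Type := set_type (`[0, 1]%classic : set R).
HB.instance Definition _ := Topological.on unitI.

Definition uval (s : unitI) : R := set_val s.

Lemma clampI_subproof (x : R) :
  Num.max 0 (Num.min 1 x) \in (`[0, 1]%classic : set R).
Proof.
rewrite inE /= in_itv /= le_max lexx /=.
by rewrite ge_max ler01 ge_min lexx.
Qed.

(* The nearest point of [0, 1]: the identity on [0, 1], which is where the
   path operations below use it. *)
Definition clampI (x : R) : unitI :=
  exist (fun y => y \in (`[0, 1]%classic : set R)) _ (clampI_subproof x).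

Lemma uval_ge0 s : 0 <= uval s.
Proof. by have := set_valP s; rewrite /= in_itv /= => /andP[]. Qed.

Lemma uval_le1 s : uval s <= 1.
Proof. by have := set_valP s; rewrite /= in_itv /= => /andP[]. Qed.

Lemma clampIE x : uval (clampI x) = Num.max 0 (Num.min 1 x).
Proof. by rewrite /uval set_valE. Qed.

Lemma clampIK x : 0 <= x -> x <= 1 -> uval (clampI x) = x.
Proof. by move=> x0 x1; rewrite clampIE (min_idPr x1) (max_idPr x0). Qed.

Lemma uval_inj : injective uval.
Proof. by move=> s t; rewrite /uval !set_valE => /val_inj. Qed.

Lemma uvalK : cancel uval clampI.
Proof.
by move=> s; apply: uval_inj; rewrite clampIK// ?uval_ge0 ?uval_le1.
Qed.

Lemma uval_continuous : continuous uval.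
Proof. exact: initial_continuous. Qed.

Lemma clampI_continuous : continuous clampI.
Proof.
apply: continuous_comp_initial => x.
have -> : set_val \o clampI = (fun x => Num.max 0 (Num.min 1 x)).
  by apply/funext => y; rewrite /= -clampIE.
apply: (@continuous_max _ _ (cst 0)); first exact: cst_continuous.
by apply: (@continuous_min _ _ (cst 1)); [exact: cst_continuous|exact: cvg_id].
Qed.

End unit_interval.

Section loops.
Variables (R : realType) (T : Type) (c : cech T) (b : T).

Local Notation I := (unitI R).
Local Notation cI := (cech_top I).
Local Notation I0 := (clampI (0 : R)).
Local Notation I1 := (clampI (1 : R)).

Record loop := Loop {
  loop_fun :> I -> T;
  loop_continuous : cech_continuous cI c loop_fun;
  loop0 : loop_fun I0 = b;
  loop1 : loop_fun I1 = b }.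

HB.instance Definition _ := gen_eqMixin loop.
HB.instance Definition _ := gen_choiceMixin loop.

Definition homotopic (v w : loop) : Prop := exists H : I * I -> T,
  [/\ cech_continuous (cech_prod cI cI) c H,
      forall s, H (s, I0) = v s, forall s, H (s, I1) = w s,
      forall t, H (I0, t) = b & forall t, H (I1, t) = b].

Lemma cech_continuous_glue (X : topologicalType) (h : X -> R) (a : R)
    (f g : X -> T) :
  continuous h -> (forall x, h x = a -> f x = g x) ->
  cech_continuous (cech_top X) c f -> cech_continuous (cech_top X) c g ->
  cech_continuous (cech_top X) c (fun x => if h x <= a then f x else g x).
Proof.
move=> ch fg cf cg S _ [x clx <-]; set F := fun x => _.
have closed_le : closed [set y | h y <= a].
  by apply: (@preimage_closed _ _ h [set r | r <= a]) => //; exact: closed_le.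
have closed_ge : closed [set y | a <= h y].
  by apply: (@preimage_closed _ _ h [set r | a <= r]) => //; exact: closed_ge.
have SE : S = (S `&` [set y | h y <= a]) `|` (S `&` [set y | a <= h y]).
  by rewrite -setIUr setIC; apply/esym/setIidr => y _ /=;
    apply/orP; exact: le_total.
have Fle y : h y <= a -> F y = f y by rewrite /F => ->.
have Fge y : a <= h y -> F y = g y.
  by rewrite /F; case: ltgtP => // /esym/fg.
move: clx; rewrite {1}SE cech_clU => -[] clx.
- have xle : h x <= a by apply/closed_le/(closureI clx).2.
  rewrite -/(F x) Fle //.
  have : c (f @` (S `&` [set y | h y <= a])) (f x) by apply: cf; exists x.
  apply: cech_mono => _ [y [Sy yle] <-]; exists y => //; exact: Fle.
- have xge : a <= h x by apply/closed_ge/(closureI clx).2.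
  rewrite -/(F x) Fge //.
  have : c (g @` (S `&` [set y | a <= h y])) (g x) by apply: cg; exists x.
  apply: cech_mono => _ [y [Sy yge] <-]; exists y => //; exact: Fge.
Qed.

Lemma cech_continuous_reparam (X : topologicalType) (f : I -> T) (g : X -> R) :
  cech_continuous cI c f -> continuous g ->
  cech_continuous (cech_top X) c (f \o (@clampI R) \o g).
Proof.
move=> cf cg; apply: cech_continuous_comp (continuous_cech _) _; last first.
  by apply: cech_continuous_comp (cf); exact/continuous_cech/clampI_continuous.
by move=> x; exact: cg.
Qed.

Lemma cech_continuous_square (H : I * I -> T) :
  cech_continuous (cech_prod cI cI) c H <->
  cech_continuous (cech_top (I * I)%type) c H.
Proof. by split=> cH S; have := cH S; rewrite cech_prod_top. Qed.

Lemma cech_continuous_reparam2 (X : topologicalType) (H : I * I -> T)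
    (g h : X -> R) :
  cech_continuous (cech_prod cI cI) c H -> continuous g -> continuous h ->
  cech_continuous (cech_top X) c (fun x => H (clampI (g x), clampI (h x))).
Proof.
move=> /cech_continuous_square cH cg ch.
apply: (@cech_continuous_comp _ _ _ _ _ _
  (fun x => (clampI (g x), clampI (h x))) H); last exact: cH.
apply: continuous_cech => x.
have clampc (k : X -> R) : continuous k ->
    (fun y => clampI (k y)) @ x --> clampI (k x).
  move=> ck; apply: (@continuous_comp _ _ _ k); first exact: ck.
  exact: clampI_continuous.
exact: (cvg_pair (clampc g cg) (clampc h ch)).
Qed.

Section affine.
Variables (X : topologicalType) (h : X -> R).
Hypothesis ch : continuous h.

Lemma continuous_rev : continuous (fun x => 1 - h x).
Proof. by move=> x; apply: cvgB; [exact: cvg_cst|exact: ch]. Qed.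

Lemma continuous_double : continuous (fun x => 2 * h x).
Proof. by move=> x; apply: cvgMr; exact: ch. Qed.

Lemma continuous_double1 : continuous (fun x => 2 * h x - 1).
Proof.
by move=> x; apply: cvgB; [exact: continuous_double|exact: cvg_cst].
Qed.

End affine.

Let u1_continuous : continuous (fun p : I * I => uval p.1).
Proof.
move=> p; apply: (@continuous_comp _ _ _ fst); first exact: cvg_fst.
exact: uval_continuous.
Qed.

Let u2_continuous : continuous (fun p : I * I => uval p.2).
Proof.
move=> p; apply: (@continuous_comp _ _ _ snd); first exact: cvg_snd.
exact: uval_continuous.
Qed.

Lemma uval0 : uval I0 = 0 :> R. Proof. by rewrite clampIK. Qed.
Lemma uval1 : uval I1 = 1 :> R. Proof. by rewrite clampIK. Qed.

Lemma homotopic_refl v : homotopic v v.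
Proof.
exists (v \o fst); split=> [|//|//|t|t] /=; last 2 first.
- exact: loop0.
- exact: loop1.
apply/cech_continuous_square.
apply: (cech_continuous_comp (d := cI)); last exact: loop_continuous.
by apply: continuous_cech => p; exact: cvg_fst.
Qed.

Lemma homotopic_sym v w : homotopic v w -> homotopic w v.
Proof.
move=> [H [cH H0 H1 Hl Hr]].
exists (fun p => H (clampI (uval p.1), clampI (1 - uval p.2))).
split=> [|s|s|t|t] /=.
- apply/cech_continuous_square/cech_continuous_reparam2 => //.
  exact/continuous_rev/u2_continuous.
- by rewrite uval0 subr0 uvalK.
- by rewrite uval1 subrr uvalK.
- by rewrite uval0.
- by rewrite uval1.
Qed.

Lemma homotopic_trans v u w : homotopic u v -> homotopic v w -> homotopic u w.
Proof.
move=> [H [cH H0 H1 Hl Hr]] [K [cK K0 K1 Kl Kr]].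
exists (fun p => if uval p.2 <= 1 / 2
  then H (clampI (uval p.1), clampI (2 * uval p.2))
  else K (clampI (uval p.1), clampI (2 * uval p.2 - 1))).
split=> [|s|s|t|t] /=.
- apply/cech_continuous_square.
  apply: (@cech_continuous_glue _ (fun p : I * I => uval p.2) (1 / 2)) => //.
  + move=> p pE; rewrite pE.
    have -> : 2 * (1 / 2) = 1 :> R by lra.
    by rewrite subrr H1 K0.
  + apply: cech_continuous_reparam2 => //.
    exact/continuous_double/u2_continuous.
  + apply: cech_continuous_reparam2 => //.
    exact/continuous_double1/u2_continuous.
- by rewrite uval0 mulr0 uvalK H0 ifT //; lra.
- rewrite uval1 ifF; last by apply/negbTE; rewrite -ltNge; lra.
  by rewrite uvalK (_ : 2 * 1 - 1 = 1) ?K1//; lra.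
- by rewrite uval0 Hl Kl if_same.
- by rewrite uval1 Hr Kr if_same.
Qed.

Definition homotopicb (v w : loop) : bool := `[< homotopic v w >].

Lemma homotopicb_refl : reflexive homotopicb.
Proof. by move=> v; apply/asboolP; exact: homotopic_refl. Qed.

Lemma homotopicb_sym : symmetric homotopicb.
Proof. by move=> v w; apply/asboolP/asboolP; exact: homotopic_sym. Qed.

Lemma homotopicb_trans : transitive homotopicb.
Proof.
move=> v u w /asboolP uv /asboolP vw.
by apply/asboolP; exact: homotopic_trans vw.
Qed.

Canonical homotopic_equiv :=
  EquivRel homotopicb homotopicb_refl homotopicb_sym homotopicb_trans.

Definition pi1 : Type := {eq_quot homotopicb}.
HB.instance Definition _ := Choice.on pi1.
HB.instance Definition _ := EqQuotient.on pi1.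

Lemma pi1P v w : \pi_pi1 v = \pi_pi1 w <-> homotopic v w.
Proof. by split=> [/eqmodP/asboolP//|vw]; apply/eqmodP/asboolP. Qed.

Lemma homotopic_reparam (v : I -> T) (f g : R -> R) (u w : loop) :
  cech_continuous cI c v -> continuous f -> continuous g ->
  f 0 = g 0 -> f 1 = g 1 ->
  (forall x, 0 <= x <= 1 -> u (clampI x) = v (clampI (f x))) ->
  (forall x, 0 <= x <= 1 -> w (clampI x) = v (clampI (g x))) ->
  homotopic u w.
Proof.
move=> cv cf cg fg0 fg1 uE' wE'.
have uE s : u s = v (clampI (f (uval s))).
  by rewrite -{1}[s]uvalK uE' // uval_ge0 uval_le1.
have wE s : w s = v (clampI (g (uval s))).
  by rewrite -{1}[s]uvalK wE' // uval_ge0 uval_le1.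
pose h (p : I * I) := (1 - uval p.2) * f (uval p.1) + uval p.2 * g (uval p.1).
exists (fun p => v (clampI (h p))); rewrite /h; split=> [|s|s|t|t] /=.
- apply/cech_continuous_square.
  apply: (@cech_continuous_reparam _ v h cv) => p.
  apply: cvgD; apply: cvgM.
  + exact: (continuous_rev u2_continuous).
  + apply: (@continuous_comp _ _ _ (fun p : I * I => uval p.1) f).
      exact: u1_continuous.
    exact: cf.
  + exact: u2_continuous.
  + apply: (@continuous_comp _ _ _ (fun p : I * I => uval p.1) g).
      exact: u1_continuous.
    exact: cg.
- by rewrite uE uval0 subr0 mul1r mul0r addr0.
- by rewrite wE uval1 subrr mul1r mul0r add0r.
- rewrite uval0 -fg0 -[RHS](loop0 u) uE uval0; congr (v (clampI _)); ring.
- rewrite uval1 -fg1 -[RHS](loop1 u) uE uval1; congr (v (clampI _)); ring.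
Qed.

Definition cst_loop : loop :=
  @Loop (fun=> b) (@cech_continuous_cst _ _ cI c b) erefl erefl.

Section inverse_loop.
Variable v : loop.

Definition rev_fun (s : I) : T := v (clampI (1 - uval s)).

Fact rev_continuous : cech_continuous cI c rev_fun.
Proof.
apply: (@cech_continuous_reparam _ v (fun s => 1 - uval s)).
  exact: loop_continuous.
exact/continuous_rev/uval_continuous.
Qed.

Fact rev_fun0 : rev_fun I0 = b.
Proof. by rewrite /rev_fun uval0 subr0 loop1. Qed.

Fact rev_fun1 : rev_fun I1 = b.
Proof. by rewrite /rev_fun uval1 subrr loop0. Qed.

Definition rev_loop : loop := Loop rev_continuous rev_fun0 rev_fun1.

End inverse_loop.

Section concatenation.
Variables v w : loop.

Definition cat_fun (s : I) : T :=
  if uval s <= 1 / 2 then v (clampI (2 * uval s))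
  else w (clampI (2 * uval s - 1)).

Fact cat_continuous : cech_continuous cI c cat_fun.
Proof.
apply: (@cech_continuous_glue _ (@uval R) (1 / 2)).
- exact: uval_continuous.
- move=> s ->; have -> : 2 * (1 / 2) = 1 :> R by lra.
  by rewrite subrr loop1 loop0.
- apply: (@cech_continuous_reparam _ v (fun s => 2 * uval s)).
    exact: loop_continuous.
  exact/continuous_double/uval_continuous.
- apply: (@cech_continuous_reparam _ w (fun s => 2 * uval s - 1)).
    exact: loop_continuous.
  exact/continuous_double1/uval_continuous.
Qed.

Fact cat_fun0 : cat_fun I0 = b.
Proof. by rewrite /cat_fun uval0 mulr0 loop0 ifT //; lra. Qed.

Fact cat_fun1 : cat_fun I1 = b.
Proof.
rewrite /cat_fun uval1 ifF; last by apply/negbTE; rewrite -ltNge; lra.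
by rewrite (_ : 2 * 1 - 1 = 1) ?loop1//; lra.
Qed.

Definition cat_loop : loop := Loop cat_continuous cat_fun0 cat_fun1.

End concatenation.

Lemma cat_homotopic v v' w w' :
  homotopic v v' -> homotopic w w' -> homotopic (cat_loop v w) (cat_loop v' w').
Proof.
move=> [H [cH H0 H1 Hl Hr]] [K [cK K0 K1 Kl Kr]].
exists (fun p => if uval p.1 <= 1 / 2
  then H (clampI (2 * uval p.1), clampI (uval p.2))
  else K (clampI (2 * uval p.1 - 1), clampI (uval p.2))).
split=> [|s|s|t|t] /=.
- apply/cech_continuous_square.
  apply: (@cech_continuous_glue _ (fun p : I * I => uval p.1) (1 / 2)) => //.
  + move=> p pE; rewrite pE.
    have -> : 2 * (1 / 2) = 1 :> R by lra.
    by rewrite subrr Hr Kl.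
  + apply: cech_continuous_reparam2 => //.
    exact/continuous_double/u1_continuous.
  + apply: cech_continuous_reparam2 => //.
    exact/continuous_double1/u1_continuous.
- by rewrite uval0 H0 K0.
- by rewrite uval1 H1 K1.
- by rewrite uval0 mulr0 Hl ifT //; lra.
- rewrite uval1 ifF; last by apply/negbTE; rewrite -ltNge; lra.
  by rewrite (_ : 2 * 1 - 1 = 1) ?Kr//; lra.
Qed.

Lemma rev_homotopic v v' :
  homotopic v v' -> homotopic (rev_loop v) (rev_loop v').
Proof.
move=> [H [cH H0 H1 Hl Hr]].
exists (fun p => H (clampI (1 - uval p.1), clampI (uval p.2))).
split=> [|s|s|t|t] /=.
- apply/cech_continuous_square/cech_continuous_reparam2 => //.
  exact/continuous_rev/u1_continuous.
- by rewrite uval0 H0.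
- by rewrite uval1 H1.
- by rewrite uval0 subr0 Hr.
- by rewrite uval1 subrr Hl.
Qed.

Let cts_min (f g : R -> R) :
  continuous f -> continuous g -> continuous (fun x => Num.min (f x) (g x)).
Proof. by move=> cf cg x; apply: continuous_min; [exact: cf|exact: cg]. Qed.

Let cts_affine (a d : R) : continuous (fun x : R => a * x + d).
Proof.
by move=> x; apply: cvgD; [apply: cvgMr; exact: cvg_id|exact: cvg_cst].
Qed.

Lemma clampI_le0 (x : R) : x <= 0 -> clampI x = I0.
Proof.
move=> x0; apply: uval_inj; rewrite uval0 clampIE.
by rewrite min_r ?max_l//; lra.
Qed.

Lemma clampI_ge1 (x : R) : 1 <= x -> clampI x = I1.
Proof. by move=> x1; apply: uval_inj; rewrite uval1 clampIE min_l ?max_r. Qed.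

Lemma cat_loopl v w x : 0 <= x -> x <= 1 / 2 ->
  cat_loop v w (clampI x) = v (clampI (2 * x)).
Proof. by move=> x0 x2; rewrite /= /cat_fun clampIK ?x2//; lra. Qed.

Lemma cat_loopr v w x : 1 / 2 < x -> x <= 1 ->
  cat_loop v w (clampI x) = w (clampI (2 * x - 1)).
Proof. by move=> x0 x1; rewrite /= /cat_fun clampIK ?leNgt ?x0//; lra. Qed.

Lemma cat_homotopicA u v w :
  homotopic (cat_loop u (cat_loop v w)) (cat_loop (cat_loop u v) w).
Proof.
apply: homotopic_sym.
pose f x := Num.min (Num.min (2 * x + 0) (1 * x + 1 / 4)) (2^-1 * x + 2^-1) : R.
apply: (@homotopic_reparam (cat_loop u (cat_loop v w)) f id).
- exact: loop_continuous.
- by do 2?apply: cts_min; exact: cts_affine.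
- by move=> x; exact: cvg_id.
- by rewrite /f !min_l; lra.
- by rewrite /f [X in Num.min X _]min_r ?min_r; lra.
- move=> x /andP[x0 x1].
  have [x2|x2] := leP x (1 / 2); last first.
    have -> : f x = 2^-1 * x + 2^-1.
      by rewrite /f [X in Num.min X _]min_r ?min_r; lra.
    rewrite [LHS]cat_loopr // [RHS]cat_loopr; [|lra..].
    rewrite [RHS]cat_loopr; [|lra..].
    by congr (w (clampI _)); field.
  rewrite [LHS]cat_loopl //.
  have [x4|x4] := leP x (1 / 4).
    have -> : f x = 2 * x by rewrite /f !min_l; lra.
    rewrite [LHS]cat_loopl; [|lra..].
    by rewrite [RHS]cat_loopl //; lra.
  have -> : f x = x + 1 / 4.
    by rewrite /f [X in Num.min X _]min_r ?min_l; lra.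
  rewrite [LHS]cat_loopr; [|lra..].
  rewrite [RHS]cat_loopr; [|lra..].
  rewrite [RHS]cat_loopl; [|lra..].
  by congr (v (clampI _)); field.
- by [].
Qed.

Lemma cat_homotopic1r v : homotopic (cat_loop v cst_loop) v.
Proof.
apply: (@homotopic_reparam v (fun x => Num.min (2 * x + 0) (0 * x + 1)) id).
- exact: loop_continuous.
- by apply: cts_min; exact: cts_affine.
- by move=> x; exact: cvg_id.
- by rewrite min_l; lra.
- by rewrite min_r; lra.
- move=> x /andP[x0 x1]; have [x2|x2] := leP x (1 / 2).
    by rewrite cat_loopl // min_l ?addr0 //; lra.
  rewrite cat_loopr // min_r; last lra.
  by rewrite mul0r add0r loop1.
- by [].
Qed.

Lemma cat_homotopicVr v : homotopic (cat_loop v (rev_loop v)) cst_loop.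
Proof.
apply: (@homotopic_reparam v (fun x => Num.min (2 * x + 0) (-2 * x + 2))
          (fun x => 0 * x + 0)).
- exact: loop_continuous.
- by apply: cts_min; exact: cts_affine.
- exact: cts_affine.
- by rewrite min_l; lra.
- by rewrite min_r; lra.
- move=> x /andP[x0 x1]; have [x2|x2] := leP x (1 / 2).
    by rewrite cat_loopl // min_l ?addr0 //; lra.
  rewrite cat_loopr // min_r; last lra.
  rewrite /= /rev_fun clampIK; [|lra..].
  by congr (v (clampI _)); ring.
- by move=> x _; rewrite mul0r addr0 loop0.
Qed.

Lemma rev_loopK v : homotopic (rev_loop (rev_loop v)) v.
Proof.
apply: (@homotopic_reparam v id id) => //.
- exact: loop_continuous.
- by move=> x; exact: cvg_id.
- by move=> x; exact: cvg_id.
- move=> x /andP[x0 x1]; rewrite /= /rev_fun.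
  rewrite (clampIK x0 x1) clampIK; [|lra..].
  by rewrite subKr.
Qed.

Lemma cat_homotopicVl v : homotopic (cat_loop (rev_loop v) v) cst_loop.
Proof.
apply: homotopic_trans (cat_homotopicVr (rev_loop v)).
apply: cat_homotopic; first exact: homotopic_refl.
exact/homotopic_sym/rev_loopK.
Qed.

Lemma cat_homotopic1l v : homotopic (cat_loop cst_loop v) v.
Proof.
apply: homotopic_trans (cat_homotopic1r v).
apply: (@homotopic_trans (cat_loop (cat_loop v (rev_loop v)) v)).
  apply: cat_homotopic; last exact: homotopic_refl.
  exact/homotopic_sym/cat_homotopicVr.
apply: homotopic_trans (homotopic_sym (cat_homotopicA _ _ _)) _.
by apply: cat_homotopic; [exact: homotopic_refl|exact: cat_homotopicVl].
Qed.

Definition pi1_mul (x y : pi1) : pi1 := \pi_pi1 (cat_loop (repr x) (repr y)).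
Definition pi1_inv (x : pi1) : pi1 := \pi_pi1 (rev_loop (repr x)).
Definition pi1_one : pi1 := \pi_pi1 cst_loop.

Lemma pi1_mulE v w :
  pi1_mul (\pi_pi1 v) (\pi_pi1 w) = \pi_pi1 (cat_loop v w).
Proof. by apply/pi1P/cat_homotopic; apply/pi1P; rewrite reprK. Qed.

Lemma pi1_invE v : pi1_inv (\pi_pi1 v) = \pi_pi1 (rev_loop v).
Proof. by apply/pi1P/rev_homotopic; apply/pi1P; rewrite reprK. Qed.

Fact pi1_mulA : associative pi1_mul.
Proof.
elim/quotW=> u; elim/quotW=> v; elim/quotW=> w.
rewrite (pi1_mulE u v) (pi1_mulE v w) !pi1_mulE.
exact/pi1P/cat_homotopicA.
Qed.

Fact pi1_mul1l : left_id pi1_one pi1_mul.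
Proof.
by elim/quotW=> v; rewrite pi1_mulE; exact/pi1P/cat_homotopic1l.
Qed.

Fact pi1_mul1r : right_id pi1_one pi1_mul.
Proof.
by elim/quotW=> v; rewrite pi1_mulE; exact/pi1P/cat_homotopic1r.
Qed.

Fact pi1_mulVl : left_inverse pi1_one pi1_inv pi1_mul.
Proof.
elim/quotW=> v; rewrite pi1_invE pi1_mulE.
exact/pi1P/cat_homotopicVl.
Qed.

Fact pi1_mulVr : right_inverse pi1_one pi1_inv pi1_mul.
Proof.
elim/quotW=> v; rewrite pi1_invE pi1_mulE.
exact/pi1P/cat_homotopicVr.
Qed.

HB.instance Definition _ := isGroup.Build pi1
  pi1_mulA pi1_mul1l pi1_mul1r pi1_mulVl pi1_mulVr.

End loops.

Definition group_iso (G H : groupType) : Prop :=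
  exists f : {multiplicative G -> H}, bijective f.

Section trivial_group.

Let one := tt.
Let inv (_ : unit) := tt.
Let mul (_ _ : unit) := tt.

Fact unit_mulA : associative mul. Proof. by []. Qed.
Fact unit_mul1l : left_id one mul. Proof. by case. Qed.
Fact unit_mul1r : right_id one mul. Proof. by case. Qed.
Fact unit_mulVl : left_inverse one inv mul. Proof. by []. Qed.
Fact unit_mulVr : right_inverse one inv mul. Proof. by []. Qed.

HB.instance Definition _ := isGroup.Build unit
  unit_mulA unit_mul1l unit_mul1r unit_mulVl unit_mulVr.

End trivial_group.

(* The free group on the alphabet T, as the set of reduced words; a letter
   (a, true) stands for the generator a and (a, false) for its inverse. *)
Section free_group.
Variable T : choiceType.
Implicit Types (s t : T * bool) (u v w : seq (T * bool)).

Definition letter_inv s : T * bool := (s.1, ~~ s.2).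

Definition reduced w : bool := sorted (fun s t => t != letter_inv s) w.

Record free_group := FreeGroup {
  word :> seq (T * bool);
  word_reduced : reduced word }.

HB.instance Definition _ := [isSub for word].
HB.instance Definition _ := [Choice of free_group by <:].

Definition cons_reduce s w :=
  if w is t :: w' then if t == letter_inv s then w' else s :: w else [:: s].

Definition word_mul u v := foldr cons_reduce v u.

Definition word_inv u := rev (map letter_inv u).

Lemma letter_invK : involutive letter_inv.
Proof. by case=> a b; rewrite /letter_inv /= negbK. Qed.

Lemma reduced_tail s w : reduced (s :: w) -> reduced w.
Proof. by case: w => //= t w /andP[]. Qed.

Lemma cons_reduce_reduced s w : reduced w -> reduced (cons_reduce s w).
Proof.
case: w => //= t w; case: ifP => [_|/negbT ts] rw; last first.
  by rewrite /reduced /= ts.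
exact: (@reduced_tail t).
Qed.

Lemma cons_reduce_id s w : reduced (s :: w) -> cons_reduce s w = s :: w.
Proof. by case: w => //= t w /andP[/negbTE -> _]. Qed.

Lemma cons_reduceK s w :
  reduced w -> cons_reduce s (cons_reduce (letter_inv s) w) = w.
Proof.
case: w => [_|t w]; first by rewrite /= eqxx.
rewrite [cons_reduce (letter_inv s) _]/= letter_invK.
by case: eqP => [->|_] rw; [exact: cons_reduce_id|rewrite /= eqxx].
Qed.

Lemma word_mul_reduced u v : reduced v -> reduced (word_mul u v).
Proof. by move=> rv; elim: u => //= s u; exact: cons_reduce_reduced. Qed.

Lemma word_mulA u v w :
  reduced w -> word_mul u (word_mul v w) = word_mul (word_mul u v) w.
Proof.
move=> rw; elim: u => //= s u ->; case: (word_mul u v) => //= t x.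
case: eqP => [->|//]; rewrite cons_reduceK //.
exact: word_mul_reduced.
Qed.

Lemma word_mul0 u : reduced u -> word_mul u [::] = u.
Proof.
elim: u => //= s u IHu ru; rewrite (IHu (reduced_tail ru)).
exact: cons_reduce_id.
Qed.

Lemma word_inv_reduced u : reduced u -> reduced (word_inv u).
Proof.
rewrite /word_inv /reduced rev_sorted sorted_map.
apply: sub_sorted => s t /=; apply: contraNN => /eqP ->.
by rewrite !letter_invK.
Qed.

Lemma word_mulV u : reduced u -> word_mul (word_inv u) u = [::].
Proof.
elim: u => //= s u IHu ru.
rewrite /word_inv /= rev_cons /word_mul foldr_rcons /= letter_invK eqxx.
exact: IHu (reduced_tail ru).
Qed.

Lemma word_invK : involutive word_inv.
Proof. by move=> u; rewrite /word_inv map_rev revK (mapK letter_invK). Qed.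

Definition free_one := @FreeGroup [::] isT.

Definition free_mul (x y : free_group) : free_group :=
  FreeGroup (word_mul_reduced x (word_reduced y)).

Definition free_inv (x : free_group) : free_group :=
  FreeGroup (word_inv_reduced (word_reduced x)).

Fact free_mulA : associative free_mul.
Proof. by move=> x y z; apply: val_inj; exact/word_mulA/word_reduced. Qed.

Fact free_mul1l : left_id free_one free_mul.
Proof. by move=> x; exact: val_inj. Qed.

Fact free_mul1r : right_id free_one free_mul.
Proof. by move=> x; apply: val_inj; exact/word_mul0/word_reduced. Qed.

Fact free_mulVl : left_inverse free_one free_inv free_mul.
Proof. by move=> x; apply: val_inj; exact/word_mulV/word_reduced. Qed.

Fact free_mulVr : right_inverse free_one free_inv free_mul.
Proof.
move=> x; apply: val_inj => /=; rewrite -{1}[x : seq _]word_invK.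
exact/word_mulV/word_inv_reduced/word_reduced.
Qed.

HB.instance Definition _ := isGroup.Build free_group
  free_mulA free_mul1l free_mul1r free_mulVl free_mulVr.

End free_group.

(* Main.v *)
From HB Require Import structures.
Require Import Defs.
From mathcomp Require Import all_boot all_order all_algebra.
From mathcomp Require Import all_classical all_reals all_analysis.
From mathcomp Require Import ring lra.

Set Implicit Arguments.
Unset Strict Implicit.
Unset Printing Implicit Defensive.

Import Order.TTheory GRing.Theory Num.Theory.
Import numFieldNormedType.Exports.

Local Open Scope ring_scope.
Local Open Scope classical_set_scope.
Local Open Scope quotient_scope.

(** Write [lap j a] for the image of the real number [a] in circle [j], so that
    [lap j] is the covering of that circle by the line, and let [reach j] be
    [r_j] cut down to 1/2, the diameter of the circle.  A neighborhood base of
    [x] is given by the sets of [y] such that, on some circle containing both,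
    [x] and [y] have real coordinates at distance less than [reach j + e]
    ([wedge_nbhsP]); continuity of paths and of homotopies becomes an estimate
    on real coordinates ([wedge_continuousP]).

    When the reach is below 1/3, two points of a circle that are nearer than 1/3
    determine an integer: the difference of their coordinates in the half-open
    unit interval is within 1/3 of it.  Three points that are pairwise this near
    make a closed triangle of total length less than 1, so that the integers of
    two sides add up to that of the third: this is where 1/3 comes from.  Near
    the wedge point nothing is lost, since three pairwise near points always lie
    on a common circle ([near_triple]).  Sending a turn of circle [j] to an
    element [c j] of a group [G], with [c j = 1] if the reach is 1/2, therefore
    gives a [G]-valued cocycle on near pairs ([transition_cocycle]).  Along a path or a homotopy the cocycle is locally
    flat, hence it is integrated by a developing map on the square, which is
    simply connected ([flat_developing]).  The total variation of the developing
    map is invariant under homotopy and additive under concatenation: it is a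
    homomorphism [degree] from the fundamental group to [G], mapping the loop
    once around circle [j] to [c j].

    Conversely the windings, that is the loops [s |-> lap j (k s)], generate
    the fundamental group ([pi1_wedge_ind]).  Given a loop [v] and a time [q],
    follow a straight arc from the wedge point to [v q] and then [v] from
    time [q] on.  The arc depends on the choice of a coordinate of [v q], and a
    change of coordinate multiplies the class on the left by windings
    ([tail_lift]).  For [q] close to [s], the coordinates of [v q] can be chosen
    next to one for [v s], and then the two classes agree ([tail_local]); here
    again 1/3 makes the coordinates vary within the reach.  So modulo windings
    the class is the same at time 0, where it is [v], and at time 1, where it
    is trivial.

    If the reach is 1/2, all maps into circle [j] are continuous and its
    windings are null-homotopic ([winding_big]).  It remains to take for [G]
    the expected group: a homomorphism [psi] back from [G] with
    [psi (c j) = winding j 1] is inverse to [degree], because each composite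
    fixes generators ([pi1_wedge_iso]). *)

(** * Induction on intervals *)

Section interval_induction.
Variable R : realType.

(** Compactness and connectedness of a segment in one statement: the supremum of
    the [x] with [P c x] is attained, and cannot be less than [d]. *)
Lemma interval_induction (P : R -> R -> Prop) (c d : R) : c <= d ->
  (forall x y z, c <= x -> x <= y -> y <= z -> z <= d ->
     P x y -> P y z -> P x z) ->
  (forall x, c <= x -> x <= d -> exists2 e, 0 < e &
     forall y z, c <= y -> y <= z -> z <= d -> x - e < y -> z < x + e -> P y z) ->
  P c d.
Proof.
move=> cd glue loc.
pose S : set R := [set x | [/\ c <= x, x <= d & P c x]]%classic.
have Sc : S c.
  have [e e0 eP] := loc c (lexx c) cd.
  by split=> //; apply: eP => //; lra.
have ubS : ubound S d by move=> x [].
have supS : has_sup S by split; [exists c | exists d].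
set m := sup S.
have cm : c <= m by apply: ub_le_sup => //; exists d.
have md : m <= d by apply: ge_sup => //; exists c.
have [e e0 eP] := loc m cm md.
have [x [cx xd Px] mx] := sup_adherent e0 supS; rewrite -/m in mx.
have xm : x <= m by apply: ub_le_sup => //; exists d.
have [dm|dm] := leP (m + e) d; last first.
  by apply: (glue c x d) => //; apply: eP => //; lra.
suff : m + e / 2 <= m by lra.
apply: ub_le_sup; first by exists d.
split; [lra|lra|].
apply: (glue c x) => //; [lra|lra|].
by apply: eP => //; lra.
Qed.

Lemma locally_constant (T : Type) (D : R -> T) (c d : R) : c <= d ->
  (forall x, c <= x <= d -> exists2 e, 0 < e &
     forall y, c <= y <= d -> `|x - y| < e -> D y = D x) ->
  forall x, c <= x <= d -> D x = D c.
Proof.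
move=> cd loc x /andP[cx xd].
apply: esym; apply: (@interval_induction (fun y z => D y = D z)) => //.
  by move=> ? ? ? _ _ _ _ -> ->.
move=> y cy yx; have [|e e0 eP] := loc y; first by rewrite cy (le_trans yx).
exists e => // a b ca ab bx ya by_.
by rewrite !eP //; rewrite ?ltr_norml; lra.
Qed.

End interval_induction.

(** * Developing maps of flat transition functions *)

Section development.
Variables (R : realType) (G : groupType).
Implicit Types (h : R * R -> R * R -> G) (p q : R * R) (A B : set (R * R)).

Definition boxed (e : R) p q : bool :=
  (`|p.1 - q.1| < e) && (`|p.2 - q.2| < e).

Lemma boxed_le e e' p q : e <= e' -> boxed e p q -> boxed e' p q.
Proof. by move=> ee' /andP[p1 p2]; rewrite /boxed !(lt_le_trans _ ee'). Qed.

(** A solution of a multiplicative differential equation: [h p q] is the prescribed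
    variation from [p] to a nearby [q]. *)
Definition developing h A (Phi : R * R -> G) : Prop :=
  forall p, A p -> exists2 e, 0 < e &
    forall q, A q -> boxed e p q -> Phi q = (Phi p * h p q)%g.

(** The integrability condition for [developing].  The comparison of [q] and [s]
    is only asked for in a neighborhood of [q] that depends on [q], as two points
    that are both near [p] need not be near each other. *)
Definition flat h : Prop :=
  forall p, exists2 e, 0 < e & forall q, boxed e p q ->
    exists2 e', 0 < e' & forall s, boxed e p s -> boxed e' q s ->
      h p s = (h p q * h q s)%g.

Definition rect (a b c d : R) : set (R * R) :=
  [set p | (a <= p.1 <= b) && (c <= p.2 <= d)].

Lemma developing_sub h A B Phi :
  A `<=` B -> developing h B Phi -> developing h A Phi.
Proof.
move=> AB dB p /AB Bp; have [e e0 eP] := dB p Bp.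
by exists e => // q /AB Bq; exact: eP.
Qed.

Lemma developing_shift h A (k : G) Phi :
  developing h A Phi -> developing h A (fun p => (k * Phi p)%g).
Proof.
move=> dA p Ap; have [e e0 eP] := dA p Ap.
by exists e => // q Aq pq; rewrite (eP q Aq pq) mulgA.
Qed.

(** Two developing maps differ by a locally constant left factor. *)
Lemma developing_ratio h A Phi Psi :
  developing h A Phi -> developing h A Psi ->
  forall p, A p -> exists2 e, 0 < e & forall q, A q -> boxed e p q ->
    (Phi q * (Psi q)^-1 = Phi p * (Psi p)^-1)%g.
Proof.
move=> dPhi dPsi p Ap.
have [e e0 eP] := dPhi p Ap; have [e' e'0 eP'] := dPsi p Ap.
exists (Num.min e e'); first by rewrite lt_min e0.
move=> q Aq pq; rewrite (eP q Aq) ?(eP' q Aq).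
- by rewrite invgM mulgA mulgK.
- by apply: boxed_le pq; rewrite ge_min lexx orbT.
- by apply: boxed_le pq; rewrite ge_min lexx.
Qed.

Lemma developing_patch h A B (a : R) Phi Psi :
  (forall p, A p -> p.1 <= a) -> (forall p, B p -> a <= p.1) ->
  (forall p, A p \/ B p -> p.1 = a -> [/\ A p, B p & Phi p = Psi p]) ->
  developing h A Phi -> developing h B Psi ->
  developing h (A `|` B) (fun p => if p.1 <= a then Phi p else Psi p).
Proof.
move=> uA uB uAB dA dB p ABp.
have [pa|pa|pa] := ltgtP p.1 a.
- have Ap : A p by case: ABp => // /uB; rewrite leNgt pa.
  have [e e0 eP] := dA p Ap.
  exists (Num.min e (a - p.1)); first by rewrite lt_min e0 subr_gt0.
  move=> q ABq pq.
  have uq : q.1 < a.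
    have /andP[+ _] : boxed (a - p.1) p q.
      by apply: boxed_le pq; rewrite ge_min lexx orbT.
    by rewrite ltr_norml; lra.
  have Aq : A q by case: ABq => // /uB; rewrite leNgt uq.
  rewrite (ltW uq); apply: eP => //.
  by apply: boxed_le pq; rewrite ge_min lexx.
- have Bp : B p by case: ABp => // /uA; rewrite leNgt pa.
  have [e e0 eP] := dB p Bp.
  exists (Num.min e (p.1 - a)); first by rewrite lt_min e0 subr_gt0.
  move=> q ABq pq.
  have uq : a < q.1.
    have /andP[+ _] : boxed (p.1 - a) p q.
      by apply: boxed_le pq; rewrite ge_min lexx orbT.
    by rewrite ltr_norml; lra.
  have Bq : B q by case: ABq => // /uA; rewrite leNgt uq.
  rewrite leNgt uq /=; apply: eP => //.
  by apply: boxed_le pq; rewrite ge_min lexx.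
- have [Ap Bp E] := uAB p ABp pa.
  have [e e0 eP] := dA p Ap; have [e' e'0 eP'] := dB p Bp.
  exists (Num.min e e'); first by rewrite lt_min e0.
  move=> q ABq pq.
  have pqe : boxed e p q by apply: boxed_le pq; rewrite ge_min lexx.
  have pqe' : boxed e' p q by apply: boxed_le pq; rewrite ge_min lexx orbT.
  case: ltgtP => qa.
  + have Aq : A q by case: ABq => // /uB; rewrite leNgt qa.
    exact: eP.
  + have Bq : B q by case: ABq => // /uA; rewrite leNgt qa.
    by rewrite E; exact: eP'.
  + by have [Aq _ _] := uAB q ABq qa; exact: eP.
Qed.

(** On the common side, which is connected, the two maps differ by a constant [k];
    after multiplication of the second one by [k] they agree there. *)
Lemma developing_hglue h a b c d e Phi Psi : a <= b -> b <= c -> d <= e ->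
  developing h (rect a b d e) Phi -> developing h (rect b c d e) Psi ->
  exists Th, developing h (rect a c d e) Th.
Proof.
move=> ab bc de dPhi dPsi.
pose k := (Phi (b, d) * (Psi (b, d))^-1)%g.
have kE t : d <= t <= e -> (Phi (b, t) * (Psi (b, t))^-1)%g = k.
  apply: (@locally_constant R G
    (fun t => (Phi (b, t) * (Psi (b, t))^-1)%g)) => // x xde.
  have sub1 : rect b b d e `<=` rect a b d e.
    by move=> [p1 p2] /andP[/= ? ?]; apply/andP; split => //=; lra.
  have sub2 : rect b b d e `<=` rect b c d e.
    by move=> [p1 p2] /andP[/= ? ?]; apply/andP; split => //=; lra.
  have [|e' e'0 eP'] := developing_ratio (developing_sub sub1 dPhi)
    (developing_sub sub2 dPsi) (p := (b, x)); first by rewrite /rect /= !lexx.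
  exists e' => // y yde xy; apply: eP'; first by rewrite /rect /= !lexx.
  by rewrite /boxed /= subrr normr0 e'0.
have dS := developing_shift k dPsi.
exists (fun p => if p.1 <= b then Phi p else (k * Psi p)%g).
have -> : rect a c d e = rect a b d e `|` rect b c d e.
  apply/seteqP; split=> -[p1 p2]; rewrite /rect /=.
    by have [p1b|p1b] := leP p1 b => p1E; [left|right]; lra.
  by case=> p1E; lra.
apply: developing_patch => //.
- by move=> [p1 p2] /andP[/= /andP[]].
- by move=> [p1 p2] /andP[/= /andP[]].
- move=> [p1 p2] pE /= p1b; rewrite p1b in pE *.
  have pde : d <= p2 <= e by case: pE => /andP[].
  rewrite /rect /= !lexx ab bc pde; split=> //.
  by rewrite -(kE p2) // mulgVK.
Qed.

Lemma developing_swap h a b c d Phi : developing h (rect a b c d) Phi ->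
  developing (fun p q => h (swap_pair p) (swap_pair q)) (rect c d a b)
    (Phi \o swap_pair).
Proof.
move=> dPhi [p2 p1] /andP[cp ap].
have [|e e0 eP] := dPhi (p1, p2); first by rewrite /rect /= ap cp.
exists e => // -[q2 q1] /andP[cq aq] /andP[pq2 pq1]; apply: eP.
- by rewrite /rect /= aq cq.
- by rewrite /boxed /= pq1 pq2.
Qed.

Lemma developing_vglue h a b c d e Phi Psi : a <= b -> b <= c -> d <= e ->
  developing h (rect d e a b) Phi -> developing h (rect d e b c) Psi ->
  exists Th, developing h (rect d e a c) Th.
Proof.
move=> ab bc de /developing_swap dPhi /developing_swap dPsi.
have [Th /developing_swap dTh] := developing_hglue ab bc de dPhi dPsi.
exists (Th \o swap_pair) => p Ap; have [e' e'0 eP] := dTh p Ap.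
by exists e' => // q Aq pq; rewrite (eP q Aq pq) /= !swap_pairK.
Qed.

(** Simple connectedness of rectangles.  The point [(s, t)] has a neighborhood on
    which [h (s, t)] is a developing map, by definition of flatness; a first
    interval induction covers a horizontal strip, a second one stacks strips. *)
Lemma flat_developing h a b c d : a <= b -> c <= d -> flat h ->
  exists Phi, developing h (rect a b c d) Phi.
Proof.
move=> ab cd fl.
apply: (@interval_induction R
  (fun x y => exists Phi, developing h (rect a b x y) Phi) c d cd).
  move=> x y z _ xy yz _ [Phi dPhi] [Psi dPsi].
  exact: (developing_vglue xy yz ab dPhi dPsi).
move=> t _ _.
have [e e0 [Phi dPhi]] : exists2 e, 0 < e &
    exists Phi, developing h (rect a b (t - e) (t + e)) Phi.
  apply: (@interval_induction R (fun x y => exists2 e, 0 < e &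
    exists Phi, developing h (rect x y (t - e) (t + e)) Phi) a b ab).
    move=> x y z _ xy yz _ [e e0 [Phi dPhi]] [e' e'0 [Psi dPsi]].
    exists (Num.min e e'); first by rewrite lt_min e0.
    have ee : Num.min e e' <= e by rewrite ge_min lexx.
    have ee' : Num.min e e' <= e' by rewrite ge_min lexx orbT.
    have m0 : 0 < Num.min e e' by rewrite lt_min e0.
    move: (Num.min e e') ee ee' m0 => m ee ee' m0.
    apply: (@developing_hglue h x y z (t - m) (t + m) Phi Psi) => //; first lra.
    + apply: developing_sub dPhi => -[p1 p2] /andP[/= ? ?].
      by apply/andP; split => //=; lra.
    + apply: developing_sub dPsi => -[p1 p2] /andP[/= ? ?].
      by apply/andP; split => //=; lra.
  move=> s _ _; have [e e0 eP] := fl (s, t).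
  exists e => // y z _ yz _ sy zs.
  exists (e / 2); first lra.
  exists (h (s, t)) => -[p1 p2] /andP[/= /andP[yp pz] /andP[tp pt]].
  have [|e' e'0 eP'] := eP (p1, p2).
    by rewrite /boxed /= !ltr_norml; lra.
  exists e' => // -[q1 q2] /andP[/= /andP[yq qz] /andP[tq qt]] pq.
  by apply: eP' => //; rewrite /boxed /= !ltr_norml; lra.
exists e => // y z _ yz _ ty zt; exists Phi.
apply: developing_sub dPhi => -[p1 p2] /andP[/= ? ?].
by apply/andP; split => //=; lra.
Qed.

End development.

(** * Integers and integer powers *)

Lemma int_lt1_eq0 (R : realType) (k : int) : `|k%:~R : R| < 1 -> k = 0.
Proof.
rewrite ltr_norml => /andP[k1 k2]; apply/eqP; rewrite eq_le.
have : (-1 : int)%:~R < k%:~R :> R by rewrite mulrNz.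
have : k%:~R < (1 : int)%:~R :> R by [].
by rewrite !ltr_int -!lez1D; lra.
Qed.

Section powers.
Variable G : groupType.
Implicit Types (x : G) (k l : int).

Definition expgz x k : G :=
  match k with Posz n => x ^+ n | Negz n => x ^- n.+1 end%g.

Lemma expgz0 x : expgz x 0 = 1%g. Proof. by []. Qed.

Lemma expgz1 x : expgz x 1 = x. Proof. by []. Qed.

Lemma expgzS x k : expgz x (k + 1) = (expgz x k * x)%g.
Proof.
case: k => [n|[|n]].
- have -> : n%:Z + 1 = n.+1%:Z by rewrite -addn1 PoszD.
  by rewrite /= expgSr.
- by rewrite /= mulVg.
- have -> : Negz n.+1 + 1 = Negz n by rewrite !NegzE -[n.+2]addn1 PoszD; ring.
  by rewrite /= [in RHS]expgS invgM mulgVK.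
Qed.

Lemma expgzB1 x k : expgz x (k - 1) = (expgz x k * x^-1)%g.
Proof. by rewrite -{2}[k](subrK 1) expgzS mulgK. Qed.

(** The integers are free on one generator. *)
Lemma additive_expgz (f : int -> G) :
  (forall k l, f (k + l) = (f k * f l)%g) -> forall k, f k = expgz (f 1) k.
Proof.
move=> fD.
have f0 : f 0 = 1%g by apply: (@mulgI _ (f 0)); rewrite -fD addr0 mulg1.
elim/int_rect => [//|n IH|n IH].
- by rewrite -addn1 PoszD fD IH expgzS.
- rewrite -addn1 PoszD opprD fD IH expgzB1; congr (_ * _)%g.
  by apply: (@mulIg _ (f 1)); rewrite -fD mulVg addNr f0.
Qed.

Lemma expgzD x k l : expgz x (k + l) = (expgz x k * expgz x l)%g.
Proof.
elim/int_rect: l => [|n IH|n IH].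
- by rewrite addr0 mulg1.
- by rewrite -addn1 PoszD addrA !expgzS IH mulgA.
- by rewrite -addn1 PoszD opprD addrA !expgzB1 IH mulgA.
Qed.

Lemma expg1z k : expgz (1 : G)%g k = 1%g.
Proof. by case: k => n; rewrite /= expg1n ?invg1. Qed.

End powers.

(** * Neighborhoods in the wedge *)

Lemma cech_continuous_nbhs (Y : topologicalType) (T : Type) (c : cech T)
    (f : Y -> T) :
  cech_continuous (cech_top Y) c f <->
  forall y U, cech_nbhs c (f y) U -> nbhs y (f @^-1` U).
Proof.
split=> [cf y U fyU|nf A _ [y clAy <-]].
- rewrite -cech_nbhs_top => clU; apply: fyU.
  have : c (f @` (~` (f @^-1` U))) (f y) by apply: cf; exists y.
  by apply: cech_mono => _ [z Uz <-].
- apply: contrapT => nfy.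
  have /clAy[z [Az]] : nbhs y (f @^-1` (~` (f @` A))).
    by apply: nf; rewrite /cech_nbhs setCK.
  by apply; exists z.
Qed.

Lemma metric_clPn (R : realType) (M : metricType R) (r : R) (A : set M) (x : M) :
  ~ metric_cl r A x <->
  exists2 e, 0 < e & forall y, A y -> r + e <= mdist x y.
Proof.
have lb : has_lbound [set mdist x y | y in A].
  by exists 0 => _ [y _ <-]; exact: mdist_ge0.
split=> [nA|[e e0 eP] [[z Az]]]; last first.
  apply/negP; rewrite -ltNge; apply: (@lt_le_trans _ _ (r + e)).
    by rewrite ltrDl.
  by apply: lb_le_inf => [|_ [y Ay <-]]; [exists (mdist x z), z|exact: eP].
have [A0|/set0P[z Az]] := eqVneq A set0.
  by exists 1 => // y; rewrite A0.
have rinf : r < inf [set mdist x y | y in A].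
  by rewrite ltNge; apply/negP => le; apply: nA; split=> //; exists z.
exists (inf [set mdist x y | y in A] - r); first by rewrite subr_gt0.
by move=> y Ay; rewrite addrC subrK; apply: ge_inf => //; exists y.
Qed.

Section arcs.
Variable R : realType.
Local Notation X := (wedge_circles R).

Definition incl (j : bool) : circle R -> X := if j then @incl2 R else @incl1 R.

Lemma incl_inj j : injective (incl j).
Proof. by case: j; [exact: incl2_inj|exact: incl1_inj]. Qed.

Definition lap (j : bool) (a : R) : X := incl j (\pi_(circle R) a).

Lemma lapP (x : X) : exists j a, x = lap j a.
Proof.
have [[p ->]|[p ->]] := wedge_circlesP x.
- by exists false, (repr p); rewrite /lap /incl reprK.
- by exists true, (repr p); rewrite /lap /incl reprK.
Qed.

Lemma lap_eqP j a b : lap j a = lap j b <-> exists k : int, b = a + k%:~R.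
Proof.
rewrite /lap; split=> [/incl_inj ab|/circleP/eqP ->//].
exact/circleP/eqP.
Qed.

Lemma lap_shift j a (k : int) : lap j (a + k%:~R) = lap j a.
Proof. by apply/esym/lap_eqP; exists k. Qed.

Lemma lap0 (i j : bool) : lap i 0 = lap j 0.
Proof. by case: i j => [] [] //; rewrite /lap /incl -wedge_pt2. Qed.

Lemma lap_int (i j : bool) (k l : int) : lap i k%:~R = lap j l%:~R.
Proof.
by rewrite -[k%:~R]add0r -[l%:~R]add0r !lap_shift; exact: lap0.
Qed.

Lemma lap_circle0 a : \pi_(circle R) a = circle0 R -> exists k : int, a = k%:~R.
Proof.
by move=> /eqP /circleP[k] E; exists (- k); rewrite intrN; lra.
Qed.

Lemma lap_meet (i j : bool) a b : i != j -> lap i a = lap j b ->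
  exists k : int, a = k%:~R.
Proof.
case: i j => [] [] // _; rewrite /lap /incl.
- by move=> /esym/incl12[_ /lap_circle0]; apply.
- by move=> /incl12[/lap_circle0 + _]; apply.
Qed.

End arcs.

Section nearness.
Variables (R : realType) (r1 r2 : R) (r1_ge0 : 0 <= r1) (r2_ge0 : 0 <= r2).
Local Notation X := (wedge_circles R).
Local Notation cX := (cech_wedge_circles r1_ge0 r2_ge0).
Implicit Types (x y z : X) (i j : bool) (a b e : R).

(** Points of a circle are never more than 1/2 apart, so the closure operators of
    radius [r_j] and [reach j] are the same. *)
Definition reach j : R := Num.min (if j then r2 else r1) (1 / 2).

Definition near_in j e x y : Prop :=
  exists a b, [/\ x = lap j a, y = lap j b & `|a - b| < reach j + e].

Definition near_pt e x y : Prop := exists j, near_in j e x y.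

Lemma reach_ge0 j : 0 <= reach j.
Proof. by rewrite le_min divr_ge0 ?ler0n ?ler01 ?andbT//; case: j. Qed.

Lemma reach_le j : reach j <= 1 / 2.
Proof. by rewrite /reach ge_min lexx orbT. Qed.

Lemma reach_small j : (if j then r2 else r1) < 1 / 3 -> reach j < 1 / 3.
Proof. by move=> rj; rewrite /reach gt_min rj. Qed.

Lemma reach_large j : 1 / 2 <= (if j then r2 else r1) -> reach j = 1 / 2.
Proof. by move=> rj; rewrite /reach min_r. Qed.

(** The minimal real distance between coordinates is at most 1/2, because shifting
    by 1 in either direction does not shrink it. *)
Lemma near_in_dist j a b e :
  mdist (\pi_(circle R) a) (\pi_(circle R) b) < (if j then r2 else r1) + e ->
  0 < e -> near_in j e (lap j a) (lap j b).
Proof.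
rewrite circle_mdistE; have [k -> kmin] := circle_dist_min a b => abe e0.
exists (a + k%:~R), b; rewrite lap_shift; split => //.
have -> : a + k%:~R - b = a - b + k%:~R by ring.
have half : `|a - b + k%:~R| <= 1 / 2.
  have := kmin (k + 1); have := kmin (k - 1); rewrite intrB intrD.
  have -> : a - b + (k%:~R - 1%:~R) = (a - b + k%:~R) - 1 by ring.
  have -> : a - b + (k%:~R + 1%:~R) = (a - b + k%:~R) + 1 by ring.
  move: (a - b + k%:~R) => t.
  by case: (ger0P t); case: (ger0P (t - 1)); case: (ger0P (t + 1)); lra.
by rewrite /reach -ltrBlDr lt_min !ltrBlDr abe /=; lra.
Qed.

Lemma near_in_mdist j e p q :
  near_in j e (incl j p) (incl j q) -> mdist p q < (if j then r2 else r1) + e.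
Proof.
move=> [a [b [/incl_inj -> /incl_inj -> abe]]]; rewrite circle_mdistE.
apply: (@le_lt_trans _ _ `|a - b + (0 : int)%:~R|).
  exact: circle_dist_le.
rewrite addr0; apply: lt_le_trans abe _.
by rewrite lerD2r /reach ge_min lexx.
Qed.

(** At the wedge point, a neighborhood is a union of one ball in each circle; the
    smaller of the two excesses over the radii serves for both. *)
Lemma wedge_nbhsP x (U : set X) :
  cech_nbhs cX x U <-> exists2 e, 0 < e & forall y, near_pt e x y -> U y.
Proof.
rewrite /cech_nbhs /=; split=> [nU|[e e0 eU]].
- have half j : exists2 e, 0 < e & forall y, near_in j e x y -> U y.
    have [[p xE]|np] := pselect (exists p, x = incl j p); last first.
      exists 1 => // y [a [b [xE _ _]]].
      by exfalso; apply: np; exists (\pi_(circle R) a).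
    have : ~ metric_cl (if j then r2 else r1) (incl j @^-1` (~` U)) p.
      move=> mp; apply: nU; move: mp xE.
      by case: (j) => mp xE; [right|left]; exists p.
    move=> /metric_clPn[e e0 eP].
    exists e => // y nxy; have [a [b [_ yb _]]] := nxy.
    move: nxy; rewrite yb xE => /near_in_mdist => lt.
    apply: contrapT => /eP; rewrite leNgt => /negP; apply.
    exact: lt.
  have [e e0 eP] := half false; have [e' e'0 eP'] := half true.
  exists (Num.min e e'); first by rewrite lt_min e0.
  move=> y [[|] [a [b [xa yb ab]]]].
  + apply: eP'; exists a, b; split=> //; apply: lt_le_trans ab _.
    by rewrite lerD2l ge_min lexx orbT.
  + apply: eP; exists a, b; split=> //; apply: lt_le_trans ab _.
    by rewrite lerD2l ge_min lexx.
- have no j p : x = incl j p ->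
      ~ metric_cl (if j then r2 else r1) (incl j @^-1` (~` U)) p.
    move=> xE; apply/metric_clPn; exists e => // q nU; rewrite leNgt.
    apply/negP; rewrite -[p]reprK -[q]reprK => /near_in_dist/(_ e0) n.
    apply: nU; apply: eU; exists j; rewrite xE.
    by move: n; rewrite /lap !reprK.
  case=> -[p mp xE]; first exact: (no false p).
  exact: (no true p).
Qed.

Lemma wedge_continuousP (Y : topologicalType) (f : Y -> X) :
  cech_continuous (cech_top Y) cX f <->
  forall s e, 0 < e -> \forall t \near s, near_pt e (f s) (f t).
Proof.
rewrite cech_continuous_nbhs; split=> [nf s e e0|nf s U].
- apply: (nf s [set z | near_pt e (f s) z]).
  by apply/wedge_nbhsP; exists e.
- move=> /wedge_nbhsP[e e0 eU].
  by have := nf s e e0; apply: filterS => z; exact: eU.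
Qed.

End nearness.

(** * The transition cocycle *)

Section coordinates.
Variable R : realType.
Local Notation X := (wedge_circles R).
Implicit Types (x y z : X) (i j : bool) (a b : R).

Definition on_circle j x : Prop := exists a, x = lap j a.

(** The half-open unit interval gives each point of circle [j] one coordinate.
    The default 0 off the circle amounts to collapsing the other circle to the
    wedge point. *)
Definition coordinate j x : R := xget 0 [set a | 0 <= a < 1 /\ x = lap j a].

Lemma floor_itv01 a : 0 <= a - (Num.floor a)%:~R < 1.
Proof. by have := floor_itv a; rewrite intrD; lra. Qed.

Lemma coordinate_lap j a : coordinate j (lap j a) = a - (Num.floor a)%:~R.
Proof.
rewrite /coordinate; case: xgetP => [b _ [b01 ab]|/(_ (a - (Num.floor a)%:~R))].
- have [k bE] := (lap_eqP j a b).1 ab.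
  have a01 := floor_itv01 a.
  rewrite bE; suff -> : k = - Num.floor a by rewrite intrN.
  apply/eqP; rewrite -subr_eq0; apply/eqP; apply: (@int_lt1_eq0 R).
  by rewrite intrB intrN ltr_norml; lra.
- by case; split; [exact: floor_itv01|rewrite -mulrNz lap_shift].
Qed.

Lemma coordinateK j x : on_circle j x -> lap j (coordinate j x) = x.
Proof. by case=> a ->; rewrite coordinate_lap -mulrNz lap_shift. Qed.

Lemma coordinate_other i j a : i != j -> coordinate i (lap j a) = 0.
Proof.
move=> ij; rewrite /coordinate; case: xgetP => // b _ [b01 ab].
have [k bE] := lap_meet ij (esym ab).
rewrite bE in b01 *.
by rewrite (@int_lt1_eq0 R k) // ltr_norml; lra.
Qed.

End coordinates.

Section near_geometry.
Variables (R : realType) (r1 r2 : R) (r1_ge0 : 0 <= r1) (r2_ge0 : 0 <= r2).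
Local Notation X := (wedge_circles R).
Local Notation near_in := (near_in r1 r2).
Local Notation near_pt := (near_pt r1 r2).
Local Notation reach := (reach r1 r2).
Implicit Types (x y z : X) (i j : bool) (a b e : R).

(** The bound 1/6 keeps [reach j + e] below 1 on circles of reach 1/2 as well. *)
Lemma scale_exists (P : bool -> Prop) :
  (forall j, reach j < 1 / 3 \/ P j) ->
  exists e, 0 < e <= 1 / 6 /\ forall j, reach j + e <= 1 / 3 \/ P j.
Proof.
move=> reachP.
have half j : exists2 e, 0 < e & reach j + e <= 1 / 3 \/ P j.
  case: (reachP j) => [rj|Pj]; last by exists 1 => //; right.
  by exists (1 / 3 - reach j); [lra|left; lra].
have [[e e0 eP] [e' e'0 eP']] := (half false, half true).
exists (Num.min (1 / 6) (Num.min e e')); split.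
  by rewrite !lt_min e0 e'0 ge_min lexx andbT; lra.
have ee : Num.min (1 / 6) (Num.min e e') <= e by rewrite !ge_min lexx orbT.
have ee' : Num.min (1 / 6) (Num.min e e') <= e' by rewrite !ge_min lexx !orbT.
by case; [case: eP' => ?|case: eP => ?]; [left; lra|right|left; lra|right].
Qed.

Lemma near_in_le j e e' x y : e <= e' -> near_in j e x y -> near_in j e' x y.
Proof.
move=> ee' [a [b [xa yb ab]]]; exists a, b; split=> //.
by apply: lt_le_trans ab _; rewrite lerD2l.
Qed.

Lemma near_pt_le e e' x y : e <= e' -> near_pt e x y -> near_pt e' x y.
Proof. by move=> ee' [j /(near_in_le ee') n]; exists j. Qed.

Lemma near_lap j a b e : `|a - b| < e -> near_pt e (lap j a) (lap j b).
Proof.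
move=> ab; exists j, a, b; split=> //.
by apply: lt_le_trans ab _; rewrite lerDr reach_ge0.
Qed.

(** Shifting [a] by the integer closest to [a - b] brings it within 1/2 of [b]. *)
Lemma near_in_big j a b e : reach j = 1 / 2 -> 0 < e ->
  near_in j e (lap j a) (lap j b).
Proof.
move=> rj e0; exists (a + (- Num.floor (a - b + 1 / 2))%:~R), b.
rewrite lap_shift; split=> //; rewrite rj mulrNz.
by have := floor_itv01 (a - b + 1 / 2); rewrite ltr_norml; lra.
Qed.

Lemma near_in_on j e x y : near_in j e x y -> on_circle j x /\ on_circle j y.
Proof. by move=> [a [b [-> -> _]]]; split; [exists a|exists b]. Qed.

(** Circles meet in the wedge point only, so that nearness on another circle than
    [i] forces both points to be the wedge point. *)
Lemma near_in_transfer i e x y : 0 < e -> on_circle i x -> on_circle i y ->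
  near_pt e x y -> near_in i e x y.
Proof.
move=> e0 [a xa] [b yb] [j nxy].
have [<-//|ij] := eqVneq j i.
have [[a' xa'] [b' yb']] := near_in_on nxy.
have [k aE] : exists k : int, a = k%:~R.
  by apply: (@lap_meet _ i j a a'); rewrite 1?eq_sym// -xa -xa'.
have [l bE] : exists k : int, b = k%:~R.
  by apply: (@lap_meet _ i j b b'); rewrite 1?eq_sym// -yb -yb'.
exists 0, 0; rewrite xa yb aE bE subrr normr0 !(lap_int R i i _ 0); split=> //.
by rewrite (lt_le_trans e0)// lerDr reach_ge0.
Qed.

(** Two of the three circles that witness nearness coincide, and a circle that
    occurs twice contains all three points. *)
Lemma near_triple e x y z : 0 < e ->
  near_pt e x y -> near_pt e y z -> near_pt e x z ->
  exists i, [/\ near_in i e x y, near_in i e y z & near_in i e x z].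
Proof.
move=> e0 xy yz xz.
suff [i [ix iy iz]] : exists i, [/\ on_circle i x, on_circle i y & on_circle i z].
  by exists i; split; apply: near_in_transfer.
have [i /near_in_on[? ?]] := xy; have [j /near_in_on[? ?]] := yz.
have [l /near_in_on[? ?]] := xz.
have [ij|ij] := eqVneq i j; first by exists i; split=> //; rewrite ij.
have [il|il] := eqVneq i l; first by exists i; split=> //; rewrite il.
have jl : j = l by case: (i) (j) (l) ij il => [] [] [].
by exists j; split=> //; rewrite jl.
Qed.

Lemma near_in_coordinate j e x y : near_in j e x y ->
  exists k : int, `|coordinate j x - coordinate j y - k%:~R| < reach j + e.
Proof.
move=> [a [b [-> -> ab]]]; exists (Num.floor b - Num.floor a).
rewrite !coordinate_lap intrB.
by rewrite [X in `|X|](_ : _ = a - b) //; ring.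
Qed.

(** The integer closest to the difference of the coordinates. *)
Definition turns j x y : int := Num.floor (coordinate j x - coordinate j y + 1 / 2).

Lemma turnsE j x y (k : int) :
  `|coordinate j x - coordinate j y - k%:~R| < 1 / 2 -> turns j x y = k.
Proof.
by move=> H; apply: floor_def; move: H; rewrite ltr_norml intrD; lra.
Qed.

(** The defect of additivity is an integer, and each [turns] is within 1/3 of a
    difference of coordinates; the differences cancel and leave less than 1. *)
Lemma turns_cocycle j e x y z : reach j + e <= 1 / 3 ->
  near_in j e x y -> near_in j e y z -> near_in j e x z ->
  turns j x z = turns j x y + turns j y z.
Proof.
move=> re /near_in_coordinate[k kP] /near_in_coordinate[l lP] /near_in_coordinate[m mP].
rewrite (@turnsE j x y k); last lra.
rewrite (@turnsE j y z l); last lra.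
rewrite (@turnsE j x z m); last lra.
apply/eqP; rewrite -subr_eq0; apply/eqP; apply: (@int_lt1_eq0 R).
move: kP lP mP; rewrite !ltr_norml !(intrB, intrD); lra.
Qed.

Lemma turns_other i j x y : i != j -> on_circle j x -> on_circle j y ->
  turns i x y = 0.
Proof.
move=> ij [a ->] [b ->]; apply: turnsE.
by rewrite !coordinate_other// !subr0 normr0; lra.
Qed.

Section cocycle.
Variables (G : groupType) (c : bool -> G).

(** At most one of the two factors is nontrivial for points on a common circle;
    the product avoids a case distinction at the wedge point. *)
Definition transition x y : G :=
  (expgz (c false) (turns false x y) * expgz (c true) (turns true x y))%g.

Lemma transition_on j x y : on_circle j x -> on_circle j y ->
  transition x y = expgz (c j) (turns j x y).
Proof.
rewrite /transition; case: j => jx jy.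
- by rewrite (@turns_other false true) ?mul1g.
- by rewrite (@turns_other true false) ?mulg1.
Qed.

Lemma transition_refl x : transition x x = 1%g.
Proof.
have [j [a xa]] := lapP x.
have jx : on_circle j x by exists a.
rewrite (transition_on jx jx) (turnsE (k := 0)) //.
by rewrite !subrr normr0; lra.
Qed.

Lemma transition_cocycle e x y z : 0 < e ->
  (forall j, reach j + e <= 1 / 3 \/ c j = 1%g) ->
  near_pt e x y -> near_pt e y z -> near_pt e x z ->
  transition x z = (transition x y * transition y z)%g.
Proof.
move=> e0 ce xy yz xz; have [j [jxy jyz jxz]] := near_triple e0 xy yz xz.
have [jx jy] := near_in_on jxy; have [_ jz] := near_in_on jyz.
rewrite !(transition_on (j := j)) //.
have [re|->] := ce j; last by rewrite !expg1z mulg1.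
by rewrite -expgzD -(turns_cocycle re).
Qed.

End cocycle.

End near_geometry.

(** * The degree of a loop *)

Section degree.
Variables (R : realType) (r1 r2 : R) (r1_ge0 : 0 <= r1) (r2_ge0 : 0 <= r2).
Variables (G : groupType) (c : bool -> G).
Hypothesis cP : forall j, reach r1 r2 j < 1 / 3 \/ c j = 1%g.
Local Notation X := (wedge_circles R).
Local Notation cX := (cech_wedge_circles r1_ge0 r2_ge0).
Local Notation loopX := (loop R cX (wedge_pt R)).
Local Notation piX := (pi1 R cX (wedge_pt R)).
Local Notation I := (unitI R).
Local Notation near_pt := (near_pt r1 r2).

(** Homotopies are extended to the plane by clamping, so that the local conditions
    can be stated without reference to the boundary of the square. *)
Lemma homotopy_flat (H : I * I -> X) :
  cech_continuous (cech_prod (cech_top I) (cech_top I)) cX H ->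
  flat (fun p q : R * R => transition c (H (clampI p.1, clampI p.2))
                                        (H (clampI q.1, clampI q.2))).
Proof.
move=> cH; have [e [/andP[e0 _] eP]] := scale_exists cP.
pose K (p : R * R) := H (clampI p.1, clampI p.2).
have cK : cech_continuous (cech_top (R * R)%type) cX K.
  apply: cech_continuous_reparam2 => // p; [exact: cvg_fst|exact: cvg_snd].
have nK p : exists2 d, 0 < d & forall q, boxed d p q -> near_pt e (K p) (K q).
  have /nbhs_ballP[d d0 dP] := (wedge_continuousP r1_ge0 r2_ge0 K).1 cK p e e0.
  by exists d => // q /andP[pq1 pq2]; apply: dP.
move=> p; have [d d0 dP] := nK p; exists d => // q pq.
have [d' d'0 dP'] := nK q; exists d' => // s ps qs.
by apply: (transition_cocycle r1_ge0 r2_ge0 e0 eP); [exact: dP|exact: dP'|exact: dP].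
Qed.

(** The one-dimensional form of [developing]: up to the choice of [Phi 0], this is
    the lift of [v] to a covering with fiber [G]. *)
Definition lifting (v : loopX) (Phi : R -> G) : Prop :=
  forall s, 0 <= s <= 1 -> exists2 e, 0 < e & forall t, 0 <= t <= 1 ->
    `|s - t| < e -> Phi t = (Phi s * transition c (v (clampI s)) (v (clampI t)))%g.

Definition has_degree (v : loopX) (D : G) : Prop :=
  exists2 Phi, lifting v Phi & D = ((Phi 0)^-1 * Phi 1%R)%g.

(** The developing map of a homotopy restricts to liftings of both ends.  It is
    constant on the sides of the square, where the homotopy is at the basepoint,
    so that both ends have the same total variation.  For [v = w] this is the
    existence of a degree. *)
Lemma has_degree_homotopic v w : homotopic v w ->
  exists2 D, has_degree v D & has_degree w D.
Proof.
move=> [H [cH H0 H1 Hl Hr]].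
have [Phi dPhi] := @flat_developing R G _ 0 1 0 1 ler01 ler01 (homotopy_flat cH).
have side s : (forall t, H (clampI s, t) = wedge_pt R) -> 0 <= s <= 1 ->
    Phi (s, 1) = Phi (s, 0).
  move=> Hs s01; apply: (@locally_constant R G (fun t => Phi (s, t)) 0 1).
  - exact: ler01.
  - move=> t t01; have [|e e0 eP] := dPhi (s, t); first by rewrite /rect /= s01.
    exists e => // u u01 tu; rewrite (eP (s, u)).
    + by rewrite /= !Hs (transition_refl) mulg1.
    + by rewrite /rect /= s01.
    + by rewrite /boxed /= subrr normr0 e0.
  - by rewrite ler01 lexx.
have slice (t : R) (u : loopX) : 0 <= t <= 1 ->
    (forall s, H (s, clampI t) = u s) -> lifting u (fun s => Phi (s, t)).
  move=> t01 Hu s s01; have [|e e0 eP] := dPhi (s, t).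
    by rewrite /rect /= s01.
  exists e => // x x01 sx; rewrite (eP (x, t)) /= ?Hu //.
    by rewrite /rect /= x01.
  by rewrite /boxed /= subrr normr0 e0 andbT.
have b0 : 0 <= (0 : R) <= 1 by rewrite lexx ler01.
have b1 : 0 <= (1 : R) <= 1 by rewrite lexx ler01.
exists ((Phi (0, 0))^-1 * Phi (1%R, 0))%g.
- by exists (fun s => Phi (s, 0)) => //; apply: slice.
- exists (fun s => Phi (s, 1)); first by apply: slice.
  by rewrite !side.
Qed.

Lemma has_degree_unique v D D' : has_degree v D -> has_degree v D' -> D = D'.
Proof.
move=> [Phi lPhi ->] [Psi lPsi ->].
have b0 : 0 <= (0 : R) <= 1 by rewrite lexx ler01.
have b1 : 0 <= (1 : R) <= 1 by rewrite lexx ler01.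
have : (Phi 1%R * (Psi 1%R)^-1 = Phi 0 * (Psi 0)^-1)%g.
  apply: (@locally_constant R G (fun s => Phi s * (Psi s)^-1)%g 0 1) => //.
  move=> s s01; have [e e0 eP] := lPhi s s01; have [e' e'0 eP'] := lPsi s s01.
  exists (Num.min e e'); first by rewrite lt_min e0.
  move=> t t01; rewrite lt_min => /andP[st st'].
  by rewrite (eP t) ?(eP' t) // invgM mulgA mulgK.
move=> E; apply: (@mulgI _ (Phi 0)); rewrite mulVKg mulgA -E.
by rewrite mulgVK.
Qed.

(** A lifting of the concatenation restricts, on the two halves of the interval,
    to liftings of the factors. *)
Lemma has_degree_cat v w D E :
  has_degree v D -> has_degree w E -> has_degree (cat_loop v w) (D * E)%g.
Proof.
move=> vD wE.
have [F [Th lTh FE] _] := has_degree_homotopic (homotopic_refl (cat_loop v w)).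
have vF : has_degree v ((Th 0)^-1 * Th (1 / 2)%R)%g.
  exists (fun s => Th (s / 2)); last by rewrite mul0r.
  move=> s s01; have [|e e0 eP] := lTh (s / 2); first lra.
  exists e => // t t01 st; rewrite (eP (t / 2)); [|lra|]; last first.
    by move: st; rewrite !ltr_norml; lra.
  rewrite !cat_loopl; [|lra..].
  have h2 (x : R) : 2 * (x / 2) = x by field.
  by rewrite !h2.
have wF : has_degree w ((Th (1 / 2)%R)^-1 * Th 1%R)%g.
  exists (fun s => Th ((s + 1) / 2)); last first.
    by rewrite add0r (_ : (1 + 1) / 2 = 1) //; lra.
  have cw s : 0 <= s <= 1 -> cat_loop v w (clampI ((s + 1) / 2)) = w (clampI s).
    move=> s01; have [s0|s0] := eqVneq s 0.
      rewrite s0 add0r cat_loopl; [|lra..].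
      by rewrite loop0 (_ : 2 * (1 / 2) = 1) ?loop1 //; lra.
    have s0' : 0 < s by rewrite lt_neqAle eq_sym s0; lra.
    rewrite cat_loopr; [|lra..].
    by congr (w (clampI _)); field.
  move=> s s01; have [|e e0 eP] := lTh ((s + 1) / 2); first lra.
  exists e => // t t01 st; rewrite (eP ((t + 1) / 2)); [|lra|]; last first.
    by move: st; rewrite !ltr_norml; lra.
  by rewrite !cw.
rewrite (has_degree_unique vD vF) (has_degree_unique wE wF).
exists Th => //.
by rewrite mulgA mulgK.
Qed.

Definition degree (x : piX) : G := xget 1%g [set D | has_degree (repr x) D].

Lemma degreeE v D : has_degree v D -> degree (\pi_piX v) = D.
Proof.
move=> vD; have : homotopic v (repr (\pi_piX v)) by apply/pi1P; rewrite reprK.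
move=> /has_degree_homotopic[E vE rE].
rewrite /degree; case: xgetP => [F _ rF|/(_ _ rE)//].
by rewrite (has_degree_unique rF rE) (has_degree_unique vD vE).
Qed.

Lemma degreeM : {morph degree : x y / (x * y)%g}.
Proof.
elim/quotW => v; elim/quotW => w.
have [D vD _] := has_degree_homotopic (homotopic_refl v).
have [E wE _] := has_degree_homotopic (homotopic_refl w).
rewrite [X in degree X](_ : _ = \pi_piX (cat_loop v w)); last exact: pi1_mulE.
by rewrite (degreeE vD) (degreeE wE) (degreeE (has_degree_cat vD wE)).
Qed.

(** The coordinate of [lap j s] drops by one whenever [s] passes an
    integer, and [floor s] counts these jumps. *)
Lemma has_degree_lap j (v : loopX) :
  (forall s, 0 <= s <= 1 -> v (clampI s) = lap j s) -> has_degree v (c j).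
Proof.
move=> vE; exists (fun s => expgz (c j) (Num.floor s)); last first.
  by rewrite floor0 floor1 expgz0 expgz1 invg1 mul1g.
move=> s s01; exists (1 / 2); first lra.
move=> t t01 st; rewrite !vE //.
rewrite (@transition_on _ _ _ j); [|by exists s|by exists t].
rewrite (@turnsE _ _ _ _ (Num.floor t - Num.floor s)).
  by rewrite -expgzD addrC subrK.
rewrite !coordinate_lap intrB.
by rewrite [X in `|X|](_ : _ = s - t) //; ring.
Qed.

End degree.

(** * Charts around a point *)

Section chart.
Variables (R : realType) (r1 r2 : R) (r1_ge0 : 0 <= r1) (r2_ge0 : 0 <= r2).
Local Notation X := (wedge_circles R).
Local Notation near_in := (near_in r1 r2).
Local Notation near_pt := (near_pt r1 r2).
Local Notation reach := (reach r1 r2).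
Implicit Types (x y z : X) (i j : bool) (a b e : R).

(** The coordinate [b] of [y] is a lift adapted to [x]: it is close to the fixed
    coordinate of [x] on the same circle, possibly across an end of the
    half-open unit interval. *)
Definition chart e x y j b : Prop :=
  [/\ on_circle j x, y = lap j b & `|coordinate j x - b| < reach j + e].

Definition chart_scale e : Prop :=
  0 < e <= 1 / 6 /\ forall j, reach j + e <= 1 / 3 \/ reach j = 1 / 2.

Lemma chart_exists e x y : near_pt e x y -> exists j b, chart e x y j b.
Proof.
move=> [j [a [b [xa yb ab]]]]; exists j, (b - (Num.floor a)%:~R).
split; first by exists a.
- by rewrite -mulrNz lap_shift.
- by rewrite xa coordinate_lap [X in `|X|](_ : _ = a - b) //; ring.
Qed.

Lemma chart_near e x y j b : chart e x y j b -> near_pt e x y.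
Proof. by move=> [jx yb xb]; exists j, (coordinate j x), b; rewrite coordinateK. Qed.

(** If the chart uses another circle than [i], then [x] and [y] are the wedge
    point, [b] is an integer less than 1 in absolute value, hence 0, and the whole
    radial segment is constant. *)
Lemma chart_on e x y i j b : chart_scale e -> on_circle i x -> on_circle i y ->
  chart e x y j b ->
  exists2 b', chart e x y i b' & forall u, lap j (u * b) = lap i (u * b').
Proof.
move=> [e01 _] ix iy [jx yb xb].
have [ij|ij] := eqVneq i j; first by exists b; rewrite ij.
have [a xa] := ix; have [a' xa'] := jx; have [b'' yb''] := iy.
have jx0 : coordinate j x = 0 by rewrite xa coordinate_other // eq_sym.
have ix0 : coordinate i x = 0 by rewrite xa' coordinate_other.
have [k bk] : exists k : int, b = k%:~R.
  by apply: (@lap_meet _ j i b b''); rewrite 1?eq_sym // -yb -yb''.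
have b0 : b = 0.
  rewrite bk (@int_lt1_eq0 R k) // -bk; have := reach_le r1 r2 j.
  by move: xb; rewrite jx0 sub0r normrN; lra.
exists 0 => [|u]; last by rewrite b0 mulr0 (lap0 R j i).
split=> //; first by rewrite yb b0 (lap0 R j i).
rewrite ix0 subrr normr0; have := reach_ge0 r1_ge0 r2_ge0 i; lra.
Qed.

(** Two points in a chart whose circle distance is less than 1/3 have coordinates
    that differ by this distance up to an integer; both coordinates are within
    1/3 of that of [x], which leaves no room for a nonzero integer. *)
Lemma chart_dist e d x y z i b b' : chart_scale e -> d <= e ->
  reach i + e <= 1 / 3 -> chart e x y i b -> chart e x z i b' ->
  near_in i d y z -> `|b - b'| < reach i + d.
Proof.
move=> [e01 _] de re [_ yb xb] [_ zb' xb'] [a [a' [ya za' aa']]].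
have [k bE] := (lap_eqP i a b).1 (etrans (esym ya) yb).
have [l b'E] := (lap_eqP i a' b').1 (etrans (esym za') zb').
suff kl : k - l = 0.
  move/eqP: kl; rewrite subr_eq0 => /eqP kl.
  by rewrite bE b'E kl [X in `|X|](_ : _ = a - a') //; ring.
apply: (@int_lt1_eq0 R); rewrite intrB.
by move: xb xb' aa'; rewrite bE b'E !ltr_norml; lra.
Qed.

(** Joint continuity of the radial contraction [(y, u) |-> u y] of a chart towards
    the wedge point: straight arcs depend continuously on their end. *)
Lemma chart_scaling e d t x y z j j' b b' u u' : chart_scale e ->
  0 < d <= e -> chart e x y j b -> chart e x z j' b' -> near_pt d y z ->
  0 <= u <= 1 -> 0 <= u' <= 1 -> `|u - u'| < t ->
  near_pt (d + 2 * t) (lap j (u * b)) (lap j' (u' * b')).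
Proof.
move=> es /andP[d0 de] cy cz nyz u01 u'01 uu'.
have t0 : 0 < t by apply: le_lt_trans uu'.
have e0 : 0 < e by apply: lt_le_trans de.
have [i [xy yz xz]] := near_triple r1_ge0 r2_ge0 e0 (chart_near cy)
  (near_pt_le de nyz) (chart_near cz).
have [[ix iy] [_ iz]] := (near_in_on xy, near_in_on xz).
have [c cc ->] := chart_on es ix iy cy.
have [c' cc' ->] := chart_on es ix iz cz.
exists i; have [re|ri] := es.2 i; last by apply: near_in_big => //; lra.
have := chart_dist es de re cc cc' (near_in_transfer r1_ge0 r2_ge0 d0 iy iz nyz).
(* The fixed coordinate of [x] is less than 1, the deviation less than 2/3. *)
have cc2 : `|c'| <= 2.
  have [_ _ xc'] := cc'.
  have [a xa] := ix; move: xc'; rewrite xa coordinate_lap.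
  have := floor_itv01 a; have := reach_le r1 r2 i; have := es.1.
  by rewrite ler_norml ltr_norml; lra.
move=> ccd; exists (u * c), (u' * c'); split=> //.
have -> : u * c - u' * c' = u * (c - c') + (u - u') * c' by ring.
apply: (le_lt_trans (ler_normD _ _)); rewrite !normrM.
have : `|u| * `|c - c'| <= `|c - c'|.
  by apply: ler_piMl => //; rewrite ler_norml; lra.
have : `|u - u'| * `|c'| <= t * 2.
  by apply: ler_pM => //; exact: ltW.
by lra.
Qed.

End chart.

(** * Classes of loops given by functions on the line *)

Section loop_classes.
Variables (R : realType) (T : Type) (c : cech T) (pt : T).
Local Notation I := (unitI R).
Local Notation loopT := (loop R c pt).
Local Notation piT := (pi1 R c pt).
Implicit Types (f : R -> T).

Definition loopable f : Prop :=
  [/\ cech_continuous (cech_top I) c (f \o @uval R), f 0 = pt & f 1 = pt].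

Lemma loopable_loop f : loopable f ->
  { v : loopT | forall s, 0 <= s <= 1 -> v (clampI s) = f s }.
Proof.
move=> [cf f0 f1]; apply: cid.
have b0 : (f \o @uval R) (clampI 0) = pt by rewrite /= uval0.
have b1 : (f \o @uval R) (clampI 1) = pt by rewrite /= uval1.
by exists (Loop cf b0 b1) => s /andP[s0 s1]; rewrite /= clampIK.
Qed.

(** Loops are records over the subtype [0, 1]; this total function allows them to
    be given by formulas in a real variable, with the unit class as default. *)
Definition loop_class f : piT :=
  if pselect (loopable f) is left lf then \pi_piT (sval (loopable_loop lf))
  else pi1_one R c pt.

Lemma loop_eq_homotopic (v w : loopT) :
  (forall s, 0 <= s <= 1 -> v (clampI s) = w (clampI s)) -> homotopic v w.
Proof.
move=> vw; apply: (@homotopic_reparam _ _ _ _ w id id) => //.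
- exact: loop_continuous.
- by move=> x; exact: cvg_id.
- by move=> x; exact: cvg_id.
Qed.

Lemma loop_classE f (v : loopT) : (forall s, 0 <= s <= 1 -> v (clampI s) = f s) ->
  loopable f /\ loop_class f = \pi_piT v.
Proof.
move=> vf; have lf : loopable f.
  split.
  - have -> : f \o @uval R = v.
      apply/funext => s /=; rewrite -vf ?uvalK //.
      by rewrite uval_ge0 uval_le1.
    exact: loop_continuous.
  - by rewrite -vf ?loop0 // lexx ler01.
  - by rewrite -vf ?loop1 // lexx ler01.
split=> //; rewrite /loop_class; case: pselect => // lf'.
case: loopable_loop => w wf /=; apply/pi1P/loop_eq_homotopic => s s01.
by rewrite vf // wf.
Qed.

Lemma loop_classP f : loopable f ->
  exists2 v : loopT, forall s, 0 <= s <= 1 -> v (clampI s) = f s &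
    loop_class f = \pi_piT v.
Proof.
move=> lf; have [v vf] := loopable_loop lf.
by exists v => //; have [] := loop_classE vf.
Qed.

Lemma loop_class_eq f g : (forall s, 0 <= s <= 1 -> f s = g s) ->
  loopable f -> loop_class f = loop_class g.
Proof.
move=> fg lf; have [v vf ->] := loop_classP lf.
by apply/esym; apply: (proj2 (loop_classE _)) => s s01; rewrite vf ?fg.
Qed.

Lemma loop_class_homotopy (H : R -> R -> T) :
  cech_continuous (cech_top (I * I)%type) c (fun p => H (uval p.1) (uval p.2)) ->
  (forall t, 0 <= t <= 1 -> H 0 t = pt /\ H 1 t = pt) ->
  (forall t, 0 <= t <= 1 -> loopable (H ^~ t)) /\
  loop_class (H ^~ 0) = loop_class (H ^~ 1).
Proof.
move=> cH Hpt.
have lH t : 0 <= t <= 1 -> loopable (H ^~ t).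
  move=> t01; have [H0 H1] := Hpt t t01; split=> //.
  have -> : (H^~ t) \o @uval R =
      (fun p : I * I => H (uval p.1) (uval p.2)) \o (fun s => (s, clampI t)).
    by have [t0 t1] := andP t01; apply/funext => s; rewrite /= clampIK.
  apply: cech_continuous_comp cH; apply: continuous_cech => s.
  have c1 : (fun x : I => x) @ s --> s by exact: cvg_id.
  have c2 : (fun x : I => clampI t : I) @ s --> (clampI t : I).
    exact: (@cst_continuous I I (clampI t) s).
  exact: (cvg_pair c1 c2).
have b0 : 0 <= (0 : R) <= 1 by rewrite lexx ler01.
have b1 : 0 <= (1 : R) <= 1 by rewrite lexx ler01.
split=> //.
have [v vH ->] := loop_classP (lH _ b0); have [w wH ->] := loop_classP (lH _ b1).
apply/pi1P; exists (fun p => H (uval p.1) (uval p.2)).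
split=> [|s|s|t|t] /=.
- exact/cech_continuous_square.
- by rewrite uval0 -vH ?uvalK // uval_ge0 uval_le1.
- by rewrite uval1 -wH ?uvalK // uval_ge0 uval_le1.
- by rewrite uval0; apply: (Hpt _ _).1; rewrite uval_ge0 uval_le1.
- by rewrite uval1; apply: (Hpt _ _).2; rewrite uval_ge0 uval_le1.
Qed.

Lemma loop_class_cat f g : loopable f -> loopable g ->
  loopable (fun s => if s <= 1 / 2 then f (2 * s) else g (2 * s - 1)) /\
  loop_class (fun s => if s <= 1 / 2 then f (2 * s) else g (2 * s - 1)) =
  (loop_class f * loop_class g)%g.
Proof.
move=> /loop_classP[v vf ->] /loop_classP[w wg ->].
rewrite [RHS](_ : _ = \pi_piT (cat_loop v w)); last exact: pi1_mulE.
apply: loop_classE => s s01; rewrite /= /cat_fun.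
have [s0 s1] := andP s01; rewrite clampIK //.
by case: leP => s2; [rewrite vf|rewrite wg] => //; lra.
Qed.

Lemma loop_class_reparam f (phi : R -> R) : loopable f -> continuous phi ->
  phi 0 = 0 -> phi 1 = 1 -> (forall s, 0 <= s <= 1 -> 0 <= phi s <= 1) ->
  loop_class (f \o phi) = loop_class f.
Proof.
move=> lf cphi phi0 phi1 phi01; have [v vf ->] := loop_classP lf.
pose f' : I -> T := v \o @clampI R \o phi \o @uval R.
have cf' : cech_continuous (cech_top I) c f'.
  apply: (@cech_continuous_reparam _ _ _ _ v (phi \o @uval R)).
    exact: loop_continuous.
  move=> s; apply: continuous_comp; [exact: uval_continuous|exact: cphi].
have f'0 : f' (clampI 0) = pt by rewrite /f' /= uval0 phi0 loop0.
have f'1 : f' (clampI 1) = pt by rewrite /f' /= uval1 phi1 loop1.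
have wE s : 0 <= s <= 1 -> Loop cf' f'0 f'1 (clampI s) = v (clampI (phi s)).
  by move=> /andP[s0 s1]; rewrite /= /f' /= clampIK.
rewrite (proj2 (loop_classE (v := Loop cf' f'0 f'1) _)); last first.
  by move=> s s01; rewrite wE // vf //; exact: phi01.
apply/pi1P; apply: (@homotopic_reparam _ _ _ _ v phi id) => //.
- exact: loop_continuous.
- by move=> s; exact: cvg_id.
Qed.

End loop_classes.

(** * Continuity of some real functions *)

Section real_continuity.
Variable R : realType.
Implicit Types f g : R -> R.

Lemma cts_min f g :
  continuous f -> continuous g -> continuous (fun x => Num.min (f x) (g x)).
Proof. by move=> cf cg x; apply: continuous_min; [exact: cf|exact: cg]. Qed.

Lemma cts_max f g :
  continuous f -> continuous g -> continuous (fun x => Num.max (f x) (g x)).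
Proof. by move=> cf cg x; apply: continuous_max; [exact: cf|exact: cg]. Qed.

Lemma cts_affine (a d : R) : continuous (fun x : R => a * x + d).
Proof.
by move=> x; apply: cvgD; [apply: cvgMr; exact: cvg_id|exact: cvg_cst].
Qed.

Lemma cts_cst (d : R) : continuous (fun x : R => d).
Proof. by move=> x; exact: cvg_cst. Qed.

Lemma cts_mulr f (a : R) : continuous f -> continuous (fun x : R => f x * a).
Proof. by move=> cf x; apply: cvgM; [exact: cf|exact: cvg_cst]. Qed.

Lemma cts_add f g :
  continuous f -> continuous g -> continuous (fun x : R => f x + g x).
Proof. by move=> cf cg x; apply: cvgD; [exact: cf|exact: cg]. Qed.

Lemma uval_fst_continuous : continuous (fun p : unitI R * unitI R => uval p.1).
Proof.
move=> p; apply: (@continuous_comp _ _ _ fst); first exact: cvg_fst.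
exact: uval_continuous.
Qed.

Lemma uval_snd_continuous : continuous (fun p : unitI R * unitI R => uval p.2).
Proof.
move=> p; apply: (@continuous_comp _ _ _ snd); first exact: cvg_snd.
exact: uval_continuous.
Qed.

Lemma continuous_interpolate (l l' m : R -> R) :
  continuous l -> continuous l' -> continuous m ->
  continuous (fun p : unitI R * unitI R =>
    (1 - uval p.2) * l (m (uval p.1)) + uval p.2 * l' (m (uval p.1))).
Proof.
move=> cl cl' cm p.
have cu1 (k : R -> R) : continuous k ->
    continuous (fun p : unitI R * unitI R => k (m (uval p.1))).
  move=> ck q; apply: (@continuous_comp _ _ _ (fun p => m (uval p.1)) k).
    apply: (@continuous_comp _ _ _ (fun p => uval p.1) m).
      exact: uval_fst_continuous.
    exact: cm.
  exact: ck.
apply: cvgD; apply: cvgM.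
- exact: (continuous_rev uval_snd_continuous).
- exact: cu1.
- exact: uval_snd_continuous.
- exact: cu1.
Qed.

End real_continuity.

(** * Loops inside one circle *)

Section generation.
Variables (R : realType) (r1 r2 : R) (r1_ge0 : 0 <= r1) (r2_ge0 : 0 <= r2).
Local Notation X := (wedge_circles R).
Local Notation cX := (cech_wedge_circles r1_ge0 r2_ge0).
Local Notation pt := (wedge_pt R).
Local Notation loopX := (loop R cX pt).
Local Notation piX := (pi1 R cX pt).
Local Notation I := (unitI R).
Local Notation near_pt := (near_pt r1 r2).
Local Notation reach := (reach r1 r2).
Local Notation class := (@loop_class R X cX pt).
Local Notation loopable := (@loopable R X cX pt).

Lemma lap_pt j (k : int) : lap j k%:~R = pt :> X.
Proof. by rewrite (lap_int R j false k 0). Qed.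

Lemma lap0_pt j : lap j 0 = pt :> X.
Proof. exact: (lap_pt j 0). Qed.

Lemma lap_continuous (Y : topologicalType) j (phi : Y -> R) :
  continuous phi -> cech_continuous (cech_top Y) cX (lap j \o phi).
Proof.
move=> cphi; apply/(wedge_continuousP r1_ge0 r2_ge0) => s e e0.
have /cvgrPdist_lt/(_ e e0) := cphi s.
by apply: filterS => t; exact: near_lap.
Qed.

Lemma square_continuous (K : R -> R -> X) :
  (forall s t e, 0 <= s <= 1 -> 0 <= t <= 1 -> 0 < e -> exists2 d, 0 < d &
     forall s' t', 0 <= s' <= 1 -> 0 <= t' <= 1 -> `|s - s'| < d ->
       `|t - t'| < d -> near_pt e (K s t) (K s' t')) ->
  cech_continuous (cech_top (I * I)%type) cX (fun p => K (uval p.1) (uval p.2)).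
Proof.
move=> nK; apply/(wedge_continuousP r1_ge0 r2_ge0) => -[s t] e e0 /=.
have u01 (u : I) : 0 <= uval u <= 1 by rewrite uval_ge0 uval_le1.
have [d d0 dP] := nK _ _ _ (u01 s) (u01 t) e0.
have near_u (u : I) : \forall u' \near u, `|uval u - uval u'| < d.
  by have /cvgrPdist_lt/(_ d d0) := @uval_continuous R u.
exists ([set u | `|uval s - uval u| < d], [set u | `|uval t - uval u| < d]).
  by split; apply: near_u.
by move=> [s' t'] [/= ss' tt']; apply: dP.
Qed.

(** Straight-line homotopy in the real coordinate. *)
Lemma lap_homotopy j (l l' : R -> R) (k : int) :
  continuous l -> continuous l' -> l 0 = 0 -> l' 0 = 0 ->
  l 1 = k%:~R -> l' 1 = k%:~R ->
  loopable (lap j \o l) /\ class (lap j \o l) = class (lap j \o l').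
Proof.
move=> cl cl' l0 l'0 l1 l'1.
have [||lH E] := @loop_class_homotopy R X cX pt
    (fun s t => lap j ((1 - t) * l s + t * l' s)).
- have := @continuous_interpolate R l l' id cl cl' (fun x => cvg_id).
  exact: (@lap_continuous (I * I)%type j).
- move=> t t01; rewrite l0 l'0 !mulr0 addr0 lap0_pt; split=> //.
  by rewrite l1 l'1 -mulrDl subrK mul1r lap_pt.
have b0 : 0 <= (0 : R) <= 1 by rewrite lexx ler01.
have E0 : (fun s => lap j ((1 - 0) * l s + 0 * l' s)) = lap j \o l.
  by apply/funext => s /=; rewrite subr0 mul1r mul0r addr0.
have E1 : (fun s => lap j ((1 - 1) * l s + 1 * l' s)) = lap j \o l'.
  by apply/funext => s /=; rewrite subrr mul0r mul1r add0r.
by rewrite -E0 -E1; split=> //; exact: lH.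
Qed.

Definition winding j (k : int) : piX := class (fun s => lap j (k%:~R * s + 0)).

Lemma winding_loopable j k : loopable (fun s => lap j (k%:~R * s + 0)).
Proof.
have [] // := @lap_homotopy j (fun s => k%:~R * s + 0) (fun s => k%:~R * s + 0) k;
  by rewrite ?mulr0 ?mulr1 ?addr0 //; exact: cts_affine.
Qed.

Lemma windingD j k l : winding j (k + l) = (winding j k * winding j l)%g.
Proof.
have [lc <-] := loop_class_cat (winding_loopable j k) (winding_loopable j l).
apply/esym.
(* The real coordinate of the concatenation: the first summand runs to [k] on
   the first half, the second one to [l] on the second half. *)
pose f (s : R) := Num.min (2 * s + 0) 1 * k%:~R + Num.max (2 * s + -1) 0 * l%:~R : R.
rewrite (loop_class_eq (g := lap j \o f)) //.
  have [||||||_ ->] := @lap_homotopy j f (fun s => (k + l)%:~R * s + 0) (k + l).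
  - by apply: cts_add; apply: cts_mulr; [apply: cts_min|apply: cts_max];
      [exact: cts_affine|exact: cts_cst|exact: cts_affine|exact: cts_cst].
  - exact: cts_affine.
  - rewrite /f min_l ?max_r; [|lra..]; ring.
  - by rewrite mulr0 addr0.
  - rewrite /f min_r ?max_l; [|lra..]; rewrite intrD; ring.
  - by rewrite mulr1 addr0.
  - by [].
move=> s /andP[s0 s1]; rewrite /f /=; case: leP => s2.
- by rewrite min_l ?max_r; [|lra..]; congr (lap j _); ring.
- rewrite min_r ?max_l; [|lra..].
  by rewrite -(lap_shift j _ k); congr (lap j _); ring.
Qed.

Lemma windingE j k : winding j k = expgz (winding j 1) k.
Proof. exact: (additive_expgz (windingD j)). Qed.

(** All points of the circle are near each other, so the loop may stay as it is
    until the last instant of the homotopy and then jump to the constant. *)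
Lemma winding_big j k : reach j = 1 / 2 -> winding j k = 1%g.
Proof.
move=> rj.
have [||lH E] := @loop_class_homotopy R X cX pt
    (fun s t => lap j (if t < 1 then k%:~R * s + 0 else 0)).
- apply: (square_continuous
    (K := fun s t => lap j (if t < 1 then k%:~R * s + 0 else 0))).
  move=> s t e s01 t01 e0; exists 1 => // s' t' _ _ _ _.
  by exists j; apply: near_in_big.
- move=> t t01; rewrite mulr0 addr0 mulr1 addr0.
  by case: ifP => _; rewrite ?lap_pt lap0_pt.
move: E; rewrite ltr01 ltxx => E; rewrite /winding [LHS]E.
by apply: (proj2 (loop_classE (v := cst_loop R cX pt) _)) => s _; rewrite lap0_pt.
Qed.

End generation.

(** * Every loop is a product of windings *)

Section tails.
Variables (R : realType) (r1 r2 : R) (r1_ge0 : 0 <= r1) (r2_ge0 : 0 <= r2).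
Local Notation X := (wedge_circles R).
Local Notation cX := (cech_wedge_circles r1_ge0 r2_ge0).
Local Notation pt := (wedge_pt R).
Local Notation loopX := (loop R cX pt).
Local Notation I := (unitI R).
Local Notation near_pt := (near_pt r1 r2).
Local Notation class := (@loop_class R X cX pt).
Local Notation loopable := (@loopable R X cX pt).
Local Notation winding := (winding r1_ge0 r2_ge0).
Variable v : loopX.

Definition extend (s : R) : X := v (clampI s).

Lemma extend0 : extend 0 = pt. Proof. exact: loop0. Qed.
Lemma extend1 s : 1 <= s -> extend s = pt.
Proof. by move=> s1; rewrite /extend clampI_ge1 ?loop1. Qed.

Lemma extend_near s e : 0 < e -> exists2 d, 0 < d &
  forall t, `|s - t| < d -> near_pt e (extend s) (extend t).
Proof.
move=> e0; have cvv : cech_continuous (cech_top R) cX extend.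
  apply: (@cech_continuous_reparam _ _ _ _ v id); first exact: loop_continuous.
  by move=> x; exact: cvg_id.
have /nbhs_ballP[d d0 dP] := (wedge_continuousP r1_ge0 r2_ge0 extend).1 cvv s e e0.
by exists d => // t; apply: dP.
Qed.

(** The arc [lap j \o l] from the wedge point to [v q], followed by [v] from time
    [q] on.  Waiting at [v q] until time [q], instead of rescaling [v], makes the
    formula continuous in [q]. *)
Definition tail j (l : R -> R) (q s : R) : X :=
  if s <= 1 / 2 then lap j (l (2 * s)) else extend (Num.max (2 * s - 1) q).

(** The arc is deformed linearly with fixed ends, while [v] stays as it is. *)
Lemma tail_homotopy j (l l' : R -> R) q : 0 <= q <= 1 ->
  continuous l -> continuous l' -> l 0 = 0 -> l' 0 = 0 ->
  extend q = lap j (l 1) -> l 1 = l' 1 ->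
  loopable (tail j l q) /\ class (tail j l q) = class (tail j l' q).
Proof.
move=> q01 cl cl' l0 l'0 vq ll'.
pose K (s t : R) := if s <= 1 / 2 then lap j ((1 - t) * l (2 * s) + t * l' (2 * s))
  else extend (Num.max (2 * s - 1) q).
have [||lK E] := @loop_class_homotopy R X cX pt K.
- apply: (@cech_continuous_glue _ _ _ _ (fun p : I * I => uval p.1) (1 / 2)
    (fun p => lap j ((1 - uval p.2) * l (2 * uval p.1) +
                     uval p.2 * l' (2 * uval p.1)))
    (fun p => extend (Num.max (2 * uval p.1 - 1) q))).
  + exact: uval_fst_continuous.
  + move=> p ->; have -> : 2 * (1 / 2) = 1 :> R by lra.
    rewrite -ll' -mulrDl subrK mul1r -vq max_r //; lra.
  + have := @continuous_interpolate R l l' ( *%R 2) cl cl'.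
    move=> /(_ (fun x => cvgMr cvg_id)).
    exact: (@lap_continuous _ _ _ r1_ge0 r2_ge0 (I * I)%type j).
  + apply: (@cech_continuous_reparam _ _ _ _ v
      (fun p : I * I => Num.max (2 * uval p.1 - 1) q)).
      exact: loop_continuous.
    move=> p; apply: (@continuous_max _ _
      (fun p : I * I => 2 * uval p.1 - 1) (fun=> q)); last exact: cvg_cst.
    exact: (continuous_double1 (@uval_fst_continuous R)).
- move=> t t01; rewrite /K mulr0 l0 l'0 !mulr0 addr0 lap0_pt.
  rewrite ifT; last lra.
  split=> //; rewrite ifF; last by apply/negbTE; rewrite -ltNge; lra.
  by rewrite extend1 // le_max; apply/orP; left; lra.
have b0 : 0 <= (0 : R) <= 1 by rewrite lexx ler01.
have E0 : K^~ 0 = tail j l q.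
  by apply/funext => s; rewrite /K /tail; case: ifP => // _; congr (lap j _); ring.
have E1 : K^~ 1 = tail j l' q.
  by apply/funext => s; rewrite /K /tail; case: ifP => // _; congr (lap j _); ring.
by rewrite -E0 -E1; split=> //; exact: lK.
Qed.

Definition ramp (b y : R) : R := Num.min y 1 * b.

Lemma ramp_continuous b : continuous (ramp b).
Proof.
apply: cts_mulr; apply: cts_min; last exact: cts_cst.
by move=> x; exact: cvg_id.
Qed.

Lemma ramp0 b : ramp b 0 = 0.
Proof. by rewrite /ramp min_l ?mul0r. Qed.

Lemma ramp1 b : ramp b 1 = b.
Proof. by rewrite /ramp min_l ?mul1r. Qed.

Lemma tail_loopable j b q : 0 <= q <= 1 -> extend q = lap j b ->
  loopable (tail j (ramp b) q).
Proof.
move=> q01 vq.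
have [||||||] // := @tail_homotopy j (ramp b) (ramp b) q q01;
  by rewrite ?ramp0 ?ramp1 //; exact: ramp_continuous.
Qed.

(** Going [k] times around and then straight to [b] is, in the real coordinate, a
    path from 0 to [k + b]; as [k] is an integer it may be joined to the arc to
    [b] without changing the points of the circle. *)
Lemma tail_shift j b q (k : int) : 0 <= q <= 1 -> extend q = lap j b ->
  class (tail j (ramp (k%:~R + b)) q) =
  (winding j k * class (tail j (ramp b) q))%g.
Proof.
move=> q01 vq.
have [lc <-] := loop_class_cat (winding_loopable r1_ge0 r2_ge0 j k)
  (tail_loopable q01 vq).
(* The product runs through the winding and the arc up to time 3/4; [l] is its
   real coordinate there, stretched to the time interval [0, 1], and [phi] below
   is the matching change of time. *)
pose l (y : R) := Num.min (3 / 2 * y + 0) 1 * k%:~R + Num.max (3 * y + -2) 0 * b : R.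
have l0 : l 0 = 0 by rewrite /l min_l ?max_r; [ring|lra..].
have l1 : l 1 = k%:~R + b by rewrite /l min_r ?max_l; [ring|lra..].
have cl : continuous l.
  apply: cts_add; apply: cts_mulr; [apply: cts_min|apply: cts_max];
    by [exact: cts_affine|exact: cts_cst].
have [|||||lt ->] := @tail_homotopy j (ramp (k%:~R + b)) l q q01 _ cl.
- exact: ramp_continuous.
- exact: ramp0.
- exact: l0.
- by rewrite ramp1 addrC lap_shift.
- by rewrite ramp1 l1.
have [||ll _] := @tail_homotopy j l l q q01 cl cl l0 l0.
- by rewrite l1 addrC lap_shift.
- by [].
pose phi (s : R) := Num.max (2 / 3 * s + 0) (2 * s + -1) : R.
rewrite -(loop_class_reparam (phi := phi) ll).
- apply/esym/loop_class_eq => // s /andP[s0 s1]; rewrite /= /phi /tail /l /ramp.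
  have [s2|s2] := leP s (1 / 2).
    rewrite max_l; [|lra]; rewrite ifT; [|lra].
    by rewrite min_l ?max_r; [|lra..]; congr (lap j _); field.
  have [s3|s3] := leP (2 * s - 1) (1 / 2).
    rewrite max_l; [|lra]; rewrite ifT; [|lra].
    rewrite min_l; [|lra]; rewrite min_r; [|lra]; rewrite max_l; [|lra].
    by rewrite -(lap_shift j _ k); congr (lap j _); field.
  have -> : Num.max (2 / 3 * s + 0) (2 * s + -1) = 2 * s - 1.
    by rewrite max_r; lra.
  rewrite ifF; last by apply/negbTE; rewrite -ltNge; lra.
  by congr (extend (Num.max _ _)); ring.
- by apply: cts_max; exact: cts_affine.
- by rewrite /phi max_l; lra.
- by rewrite /phi max_r; lra.
- by move=> s s01; rewrite /phi le_max ge_max; apply/andP; split; lra.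
Qed.

End tails.

Section generation.
Variables (R : realType) (r1 r2 : R) (r1_ge0 : 0 <= r1) (r2_ge0 : 0 <= r2).
Local Notation X := (wedge_circles R).
Local Notation cX := (cech_wedge_circles r1_ge0 r2_ge0).
Local Notation pt := (wedge_pt R).
Local Notation loopX := (loop R cX pt).
Local Notation piX := (pi1 R cX pt).
Local Notation I := (unitI R).
Local Notation near_pt := (near_pt r1 r2).
Local Notation reach := (reach r1 r2).
Local Notation class := (@loop_class R X cX pt).
Local Notation loopable := (@loopable R X cX pt).
Local Notation winding := (winding r1_ge0 r2_ge0).
Hypothesis reachP : forall j, reach j < 1 / 3 \/ reach j = 1 / 2.

Section tails.
Variable v : loopX.
Local Notation extend := (extend v).
Local Notation tail_class j b q := (class (tail v j (ramp b) q)).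

(** Coordinates on one circle differ by an integer, and [tail_shift] applies.  If
    [v q] is the wedge point seen on both circles, each coordinate is an integer
    and can be shifted to 0, where the two arcs coincide. *)
Lemma tail_lift j j' b b' q : 0 <= q <= 1 ->
  extend q = lap j b -> extend q = lap j' b' ->
  exists k l, tail_class j b q = (winding j k * winding j' l * tail_class j' b' q)%g.
Proof.
move=> q01 qb qb'.
have [jj'|jj'] := eqVneq j j'.
  move: qb'; rewrite -jj' => qb'.
  have [k ->] := (lap_eqP j b' b).1 (etrans (esym qb') qb).
  exists k, 0; rewrite [winding j 0]windingE expgz0 mulg1.
  by rewrite addrC (tail_shift _ q01 qb').
have [k bE] := lap_meet jj' (etrans (esym qb) qb').
have [l b'E] : exists l : int, b' = l%:~R.
  by apply: (lap_meet _ (etrans (esym qb') qb)); rewrite eq_sym.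
have q0 i : extend q = lap i 0 by rewrite qb bE lap_pt lap0_pt.
exists k, (- l).
have -> : tail_class j b q = (winding j k * tail_class j 0 q)%g.
  by rewrite -(tail_shift _ q01 (q0 j)) bE addr0.
rewrite -mulgA -(tail_shift _ q01 qb') b'E mulrNz addNr; congr (_ * _)%g.
apply: loop_class_eq; last exact: tail_loopable.
by move=> s _; rewrite /tail /ramp !mulr0 (lap0 R j j').
Qed.

(** Choose chart coordinates around [v s] for all the points that [v] visits
    between [s] and [q], and let the end of the arc move along [v] from [s] to [q];
    [chart_scaling] says that the arcs vary continuously. *)
Lemma tail_local s : 0 <= s <= 1 -> exists2 d, 0 < d &
  forall q, 0 <= q <= 1 -> `|s - q| < d -> exists j b j' b',
    [/\ extend s = lap j b, extend q = lap j' b' &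
        tail_class j b s = tail_class j' b' q].
Proof.
move=> s01; have [e es] := scale_exists reachP.
have e0 : 0 < e by have [] := es; lra.
have [d d0 dP] := extend_near v s e0.
have chartJ t : exists p : bool * R, `|s - t| < d ->
    chart r1 r2 e (extend s) (extend t) p.1 p.2.
  have [st|st] := ltP `|s - t| d; last by exists (false, 0).
  by have [j [b jb]] := chart_exists (dP t st); exists (j, b).
have [J JP] := choice chartJ.
exists d => // q q01 sq.
have ss : `|s - s| < d by rewrite subrr normr0.
have [_ sJ _] := JP s ss; have [_ qJ _] := JP q sq.
exists (J s).1, (J s).2, (J q).1, (J q).2; split=> //.
pose mid (t : R) : R := s + t * (q - s).
have mid01 t : 0 <= t <= 1 -> 0 <= mid t <= 1.
  by move=> t01; rewrite /mid; nra.
have midd t : 0 <= t <= 1 -> `|s - mid t| < d.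
  move=> t01; apply: le_lt_trans sq; rewrite /mid.
  rewrite [X in `|X|](_ : _ = t * (s - q)); last by ring.
  by rewrite normrM ger0_norm ?ler_piMl //; lra.
pose K (u t : R) : X := if u <= 1 / 2
  then lap (J (mid t)).1 (ramp (J (mid t)).2 (2 * u))
  else extend (Num.max (2 * u - 1) (mid t)).
have ramp01 b (u : R) : ramp b u = ramp 1 u * b by rewrite /ramp mulr1.
have [||_ E] := @loop_class_homotopy R X cX pt K.
- apply: (@cech_continuous_glue _ _ _ _ (fun p : I * I => uval p.1) (1 / 2)
    (fun p => lap (J (mid (uval p.2))).1 (ramp (J (mid (uval p.2))).2 (2 * uval p.1)))
    (fun p => extend (Num.max (2 * uval p.1 - 1) (mid (uval p.2))))).
  + exact: uval_fst_continuous.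
  + move=> p ->; have -> : 2 * (1 / 2) = 1 :> R by lra.
    have t01 : 0 <= uval p.2 <= 1 by rewrite uval_ge0 uval_le1.
    rewrite ramp1 subrr max_r; last by have := mid01 _ t01; lra.
    by have [_ <- _] := JP _ (midd _ t01).
  + apply: (@square_continuous _ _ _ r1_ge0 r2_ge0
      (fun u t => lap (J (mid t)).1 (ramp (J (mid t)).2 (2 * u)))).
    move=> u t f u01 t01 f0.
    (* [g + 2 (f / 4)] has to be at most [f], and [u |-> ramp 1 (2 u)] doubles
       distances, whence [f / 8] below. *)
    pose g := Num.min e (f / 2).
    have g0 : 0 < g by rewrite lt_min e0; lra.
    have ge : g <= e by rewrite ge_min lexx.
    have gf : g <= f / 2 by rewrite ge_min lexx orbT.
    have [d' d'0 dP'] := extend_near v (mid t) g0.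
    exists (Num.min d' (f / 8)); first by rewrite lt_min d'0; lra.
    move=> u' t' u'01 t'01; rewrite !lt_min => /andP[_ uu'] /andP[tt' _].
    rewrite ramp01 (ramp01 _ (2 * u')).
    apply: (@near_pt_le _ _ _ (g + 2 * (f / 4))); first lra.
    apply: (chart_scaling r1_ge0 r2_ge0 es _ (JP _ (midd t t01)) (JP _ (midd t' t'01))).
    * by rewrite g0.
    * apply: dP'; apply: le_lt_trans tt'; rewrite /mid.
      rewrite [X in `|X|](_ : _ = (t - t') * (s - q) * -1); last by ring.
      rewrite !normrM normrN normr1 mulr1 ler_piMr // ler_norml; lra.
    * by rewrite /ramp mulr1 le_min ge_min lexx orbT; lra.
    * by rewrite /ramp mulr1 le_min ge_min lexx orbT; lra.
    * rewrite /ramp !mulr1; move: uu'; rewrite !ltr_norml.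
      by case: (leP (2 * u) 1); case: (leP (2 * u') 1); lra.
  + apply: (@cech_continuous_reparam _ _ _ _ v
      (fun p : I * I => Num.max (2 * uval p.1 - 1) (mid (uval p.2)))).
      exact: loop_continuous.
    move=> p; apply: (@continuous_max _ _
      (fun p : I * I => 2 * uval p.1 - 1) (fun p : I * I => mid (uval p.2))).
      exact: (continuous_double1 (@uval_fst_continuous R)).
    apply: cvgD; first exact: cvg_cst.
    by apply: cvgM; [exact: uval_snd_continuous|exact: cvg_cst].
- move=> t t01; rewrite /K mulr0 ramp0 lap0_pt ifT; last lra.
  split=> //; rewrite ifF; last by apply/negbTE; rewrite -ltNge; lra.
  by rewrite extend1 // le_max; apply/orP; left; lra.
have m0 : mid 0 = s by rewrite /mid mul0r addr0.
have m1 : mid 1 = q by rewrite /mid mul1r addrC subrK.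
by move: E; rewrite /K m0 m1.
Qed.

Section induction.
Variable Q : piX -> Prop.
Hypothesis Q1 : Q 1%g.
Hypothesis QM : forall x j k, Q x -> Q (x * winding j k)%g.

Let reached (q : R) := exists j b x, [/\ extend q = lap j b, Q x &
  tail_class false 0 0 = (x * tail_class j b q)%g].

Let reached_transfer s q j b j' b' : 0 <= s <= 1 ->
  extend s = lap j b -> extend q = lap j' b' ->
  tail_class j b s = tail_class j' b' q -> reached s -> reached q.
Proof.
move=> s01 sb qb' tE [i [a [x [sa Qx E]]]].
have [k [l tl]] := tail_lift s01 sa sb.
exists j', b', (x * winding i k * winding j l)%g; split=> //.
  by do 2!apply: QM.
by rewrite E tl tE !mulgA.
Qed.

Lemma wedge_loop_ind : Q (\pi_piX v).
Proof.
have b0 : 0 <= (0 : R) <= 1 by rewrite lexx ler01.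
have b1 : 0 <= (1 : R) <= 1 by rewrite lexx ler01.
have r0 : reached 0.
  by exists false, 0, 1%g; rewrite mul1g extend0 lap0_pt.
have [j [b [x [jb Qx E]]]] : reached 1.
  apply: (@interval_induction R (fun y z => reached y -> reached z) 0 1) r0 => //.
    by move=> y z w _ _ _ _ yz zw /yz.
  move=> s s0 s1; have s01 : 0 <= s <= 1 by rewrite s0.
  have [d d0 dP] := tail_local s01.
  exists d => // y z y0 yz z1 sy zs ry.
  have [||i [a [i' [a' [sa ya' tE]]]]] := dP y; [lra|rewrite ltr_norml; lra|].
  have [||j [b [j' [b' [sb zb' tE']]]]] := dP z; [lra|rewrite ltr_norml; lra|].
  apply: (reached_transfer s01 sb zb' tE').
  by apply: (reached_transfer _ ya' sa (esym tE) ry); lra.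
have -> : \pi_piX v = tail_class false 0 0.
  apply/esym; rewrite (proj2 (loop_classE (v := cat_loop (cst_loop R cX pt) v) _)).
    exact/pi1P/cat_homotopic1l.
  move=> s s01; rewrite /= /cat_fun clampIK; [|lra..].
  rewrite /tail; case: leP => s2; first by rewrite /ramp mulr0 lap0_pt.
  by rewrite max_l //; lra.
have [k [l tl]] := tail_lift b1 jb
  (etrans (extend1 v (lexx 1)) (esym (lap0_pt R false))).
rewrite E tl (_ : tail_class false 0 1 = 1%g).
  by rewrite mulg1 mulgA; do 2!apply: QM.
apply: (proj2 (loop_classE (v := cst_loop R cX pt) _)) => s s01.
rewrite /= /tail; case: leP => s2; first by rewrite /ramp mulr0 lap0_pt.
by rewrite extend1 // le_max lexx orbT.
Qed.

End induction.
End tails.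

(** Generation of the fundamental group by windings, stated without subgroups:
    [Q] may be membership in the subgroup that they generate. *)
Lemma pi1_wedge_ind (Q : piX -> Prop) : Q 1%g ->
  (forall x j k, Q x -> Q (x * winding j k)%g) -> forall x, Q x.
Proof.
by move=> Q1 QM; elim/quotW => v; exact: wedge_loop_ind.
Qed.

End generation.

(** * The isomorphisms *)

Lemma expgz_morph (G H : groupType) (f : G -> H) :
  {morph f : x y / (x * y)%g} -> forall x k, f (expgz x k) = expgz (f x) k.
Proof.
by move=> fM x; apply: (additive_expgz (f := fun k => f (expgz x k))) => k l;
  rewrite expgzD fM.
Qed.

Section free_eval.
Variables (T : choiceType) (G : groupType) (a : T -> G).

Definition letter (t : T) : free_group T := @FreeGroup T [:: (t, true)] isT.

Definition eval_letter (s : T * bool) : G := if s.2 then a s.1 else (a s.1)^-1%g.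

Definition eval_word (w : seq (T * bool)) : G :=
  foldr (fun s x => eval_letter s * x)%g 1%g w.

Lemma eval_letter_inv s : eval_letter (letter_inv s) = (eval_letter s)^-1%g.
Proof. by case: s => t []; rewrite /eval_letter /= ?invgK. Qed.

Lemma eval_cons_reduce s w :
  eval_word (cons_reduce s w) = (eval_letter s * eval_word w)%g.
Proof.
case: w => //= t w; case: eqP => [->|//].
by rewrite eval_letter_inv mulVKg.
Qed.

Lemma eval_wordM : {morph (fun x : free_group T => eval_word x) : x y / (x * y)%g}.
Proof.
move=> [u ur] [w wr]; rewrite /= /word_mul; elim: u {ur} => [|s u IH] /=.
  by rewrite mul1g.
by rewrite eval_cons_reduce IH mulgA.
Qed.

Lemma free_group_endo_id (f : free_group T -> free_group T) :
  {morph f : x y / (x * y)%g} -> (forall t, f (letter t) = letter t) ->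
  forall x, f x = x.
Proof.
move=> fM ft [u ur]; elim: u ur => [|s u IH] ur.
  have -> : @FreeGroup T [::] ur = 1%g by apply: val_inj.
  by apply: (@mulgI _ (f 1%g)); rewrite -fM !mulg1.
have f1 : f 1%g = 1%g by apply: (@mulgI _ (f 1%g)); rewrite -fM !mulg1.
have fs b : f (@FreeGroup T [:: (s.1, b)] isT) = @FreeGroup T [:: (s.1, b)] isT.
  case: b; first exact: ft.
  have -> : @FreeGroup T [:: (s.1, false)] isT = ((letter s.1)^-1)%g.
    exact: val_inj.
  by apply: (@mulgI _ (f (letter s.1))); rewrite -fM mulgV f1 ft mulgV.
have -> : @FreeGroup T (s :: u) ur =
    (@FreeGroup T [:: (s.1, s.2)] isT * FreeGroup (reduced_tail ur))%g.
  by apply: val_inj => /=; rewrite -surjective_pairing -cons_reduce_id.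
by rewrite fM fs IH.
Qed.

End free_eval.

Section isomorphism.
Variables (R : realType) (r1 r2 : R) (r1_ge0 : 0 <= r1) (r2_ge0 : 0 <= r2).
Local Notation cX := (cech_wedge_circles r1_ge0 r2_ge0).
Local Notation piX := (pi1 R cX (wedge_pt R)).
Local Notation reach := (reach r1 r2).
Local Notation winding := (winding r1_ge0 r2_ge0).

Lemma degree_winding (G : groupType) (c : bool -> G) j :
  (forall j, reach j < 1 / 3 \/ c j = 1%g) ->
  degree (r1_ge0 := r1_ge0) (r2_ge0 := r2_ge0) c (winding j 1) = c j.
Proof.
move=> cP; have [v vE] := loop_classP (winding_loopable r1_ge0 r2_ge0 j 1).
rewrite /winding => ->; apply: degreeE => //; apply: has_degree_lap => s s01.
by rewrite vE // mul1r addr0.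
Qed.

(** The two composites of [degree] and [psi] are endomorphisms that fix the
    generators [winding j 1] of the fundamental group, respectively the elements
    [c j], which determine endomorphisms of [G]. *)
Lemma pi1_wedge_iso (G : groupType) (c : bool -> G) (psi : G -> piX) :
  (forall j, reach j < 1 / 3 \/ reach j = 1 / 2 /\ c j = 1%g) ->
  {morph psi : x y / (x * y)%g} -> (forall j, psi (c j) = winding j 1) ->
  (forall f : G -> G, {morph f : x y / (x * y)%g} ->
     (forall j, f (c j) = c j) -> forall x, f x = x) ->
  group_iso piX G.
Proof.
move=> cP psiM psic Ggen.
have cP' j : reach j < 1 / 3 \/ c j = 1%g by case: (cP j) => [|[_]]; [left|right].
have rP j : reach j < 1 / 3 \/ reach j = 1 / 2.
  by case: (cP j) => [|[]]; [left|right].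
pose deg := degree (r1_ge0 := r1_ge0) (r2_ge0 := r2_ge0) c.
have degM : {morph deg : x y / (x * y)%g} by apply: degreeM.
have degc j : deg (winding j 1) = c j by apply: degree_winding.
pose F : {multiplicative piX -> G} :=
  HB.pack deg (isMultiplicative.Build piX G deg degM).
exists F, psi => [|x]; last first.
  apply: (Ggen (deg \o psi)) => [y z|j] /=; first by rewrite psiM degM.
  by rewrite psic degc.
have fM : {morph psi \o deg : x y / (x * y)%g}.
  by move=> x y /=; rewrite degM psiM.
apply: (pi1_wedge_ind rP) => [|x j k Qx].
  have := fM 1%g 1%g; rewrite /= mulg1 => E.
  by apply: (@mulgI _ (psi (deg 1%g))); rewrite -[LHS]E mulg1.
rewrite -[LHS]/((psi \o deg) _) fM /= [psi _]Qx; congr (_ * _)%g.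
by rewrite windingE -[LHS]/((psi \o deg) _) (expgz_morph fM) /= degc psic.
Qed.

Lemma pi1_wedge_free : (forall j, reach j < 1 / 3) ->
  group_iso piX (free_group bool).
Proof.
move=> rP.
apply: (@pi1_wedge_iso _ (@letter bool)
  (fun x => eval_word (fun j => winding j 1) x)).
- by move=> j; left.
- exact: eval_wordM.
- by move=> j; rewrite /= mulg1.
- exact: free_group_endo_id.
Qed.

Lemma pi1_wedge_int i : reach i < 1 / 3 -> reach (~~ i) = 1 / 2 ->
  group_iso piX (GRing.to_multiplicative int).
Proof.
move=> ri ri'.
(* The winding number around circle [i], blind to the other circle. *)
pose c j : GRing.to_multiplicative int := if j == i then 1 else 0.
have ji j : j != i -> j = ~~ i by case: (j) (i) => [] [].
apply: (@pi1_wedge_iso _ c (winding i)).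
- move=> j; rewrite /c; case: eqVneq => [->|/ji ->]; first by left.
  by right.
- exact: windingD.
- move=> j; rewrite /c; case: eqVneq => [->//|/ji ->].
  by rewrite (winding_big _ _ _ ri') windingE.
- move=> f fM fc k; have fi : f (1 : int) = (1 : int) by have := fc i; rewrite /c eqxx.
  rewrite (additive_expgz (G := GRing.to_multiplicative int) (f := f) fM) fi.
  by rewrite -(additive_expgz (G := GRing.to_multiplicative int) (f := id)).
Qed.

Lemma pi1_wedge_trivial : (forall j, reach j = 1 / 2) -> group_iso piX unit.
Proof.
move=> rP; apply: (@pi1_wedge_iso unit (fun=> tt) (fun=> 1%g)).
- by move=> j; right.
- by move=> x y; rewrite mulg1.
- by move=> j; rewrite winding_big.
- by move=> f _ _ x; case: (f x); case: x.
Qed.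

End isomorphism.

Theorem theorem4p54 (R : realType) (r1 r2 : R)
    (r1_ge0 : 0 <= r1) (r2_ge0 : 0 <= r2) :
  let pi1X := pi1 R (cech_wedge_circles r1_ge0 r2_ge0) (wedge_pt R) in
  [/\ r1 < 1 / 3 /\ r2 < 1 / 3 -> group_iso pi1X (free_group bool),
      (r1 < 1 / 3 /\ 1 / 2 <= r2) \/ (r2 < 1 / 3 /\ 1 / 2 <= r1) ->
        group_iso pi1X (GRing.to_multiplicative int)
    & 1 / 2 <= r1 /\ 1 / 2 <= r2 -> group_iso pi1X unit].
Proof.
move=> pi1X; split=> [[r1s r2s]|[[rs rl]|[rs rl]]|[r1l r2l]].
- by apply: pi1_wedge_free => -[]; apply: reach_small.
- by apply: (@pi1_wedge_int _ _ _ _ _ false); [apply: reach_small|apply: reach_large].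
- by apply: (@pi1_wedge_int _ _ _ _ _ true); [apply: reach_small|apply: reach_large].
- by apply: pi1_wedge_trivial => -[]; apply: reach_large.
Qed.
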